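(* Let $b_0\in\,]0,\frac{\pi}{2}[$ be such that $\tan(b_0)=2b_0$. Let $\beta>0$. Then for every Riemannian metric $g$ on the Klein bottle $K$ conformal to $g_\beta$: (1) If $0<\beta\le 2\ln\left(\tan\left(\frac{\pi}{4}+\frac{b_0}{2}\right)\right)$, then $$l_v(g)\,l_\sigma(g)\le \frac{\arcsin\left(\frac{e^{\beta}-1}{e^{\beta}+1}\right)}{\frac{e^{\beta}-1}{e^{\beta}+1}}\,\mathrm{vol}(g).$$ (2) If $\beta>2\ln\left(\tan\left(\frac{\pi}{4}+\frac{b_0}{2}\right)\right)$, then $$l_v(g)\,l_\sigma(g)\le \frac{1}{2\cos(\omega)}\,\mathrm{vol}(g),$$ where $\omega\in[b_0,\frac{\pi}{2}[$ is given by $$2\sin(\omega)=\left(\beta-2\ln\left(\tan\left(\tfrac{\pi}{4}+\tfrac{\omega}{2}\right)\right)\right)\cos^2(\omega)+4\omega\cos(\omega).$$ Moreover, equality is achieved by a spherical metric in case (1) and by a flat-spherical metric in case (2).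
   Context: The Klein bottle $K$ is the quotient of $\mathbb{R}^2=\mathbb{C}$ by the group generated by $\sigma: z\mapsto \bar z+\pi$ and $t: z\mapsto z+2i\beta$, with $\beta>0$; $g_\beta$ is the flat metric induced on $K$ by the Euclidean metric. The group is identified with $\pi_1(K)$. A metric $g$ is conformal to $g_\beta$ if $g=\varphi^2 g_\beta$ for a positive function $\varphi$ on $K$; continuous metrics (continuous $\varphi$) are admitted. $\mathrm{vol}(g)$ is the total area. Lengths, measured with respect to $g$: - $l_\sigma(g)$: least length of a closed curve in the free homotopy class of the glide reflection $\sigma$; - $l_v(g)$: least length of a closed curve in the free homotopy class of the vertical translation $t$. A metric is called spherical if, outside a finite union of curves where it is only continuous, it is locally isometric, up to one global scaling constant, to the round unit sphere; it is called flat-spherical if, outside a finite union of curves where it is only continuous, it is locally isometric, up to one global scaling constant, either to the round unit sphere or to the Euclidean plane, both types occurring.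
   Formalization: The vertical translation is taken as t: z ↦ z + iβ instead of z ↦ z + 2iβ; with 2iβ the bounds fail (φ = 1/cosh y on |y| ≤ β, extended 2β-periodically, gives ratio arcsin(u)/u with u = tanh β > tanh(β/2)). *)

(* Defs.v *)
From Stdlib Require Import Reals List.
From Coquelicot Require Import Coquelicot.
Open Scope R_scope.

(* ** The Klein bottle: the plane modulo the group generated by sigma and t *)

Definition sigma (z : C) : C := (Cconj z + RtoC PI)%C.

(* The vertical period is beta.  With vertical period 2 beta the stated bounds
   would fail: the metric equal to |dz|^2 / cosh(y)^2 on |y| <= beta, extended
   with period 2 beta in y, has l_sigma = PI, l_v = 2 arcsin(tanh beta) and
   area 2 PI tanh(beta), hence ratio arcsin(u)/u with u = tanh(beta), whereas
   (e^beta - 1)/(e^beta + 1) = tanh(beta/2) < u. *)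
Definition t (beta : R) (z : C) : C := (z + Ci * RtoC beta)%C.

Inductive Gamma (beta : R) : (C -> C) -> Prop :=
| Gamma_sigma : Gamma beta sigma
| Gamma_t : Gamma beta (t beta)
| Gamma_comp : forall f h : C -> C,
    Gamma beta f -> Gamma beta h -> Gamma beta (fun z => f (h z))
| Gamma_inv : forall f h : C -> C,
    Gamma beta f -> (forall z, f (h z) = z) -> (forall z, h (f z) = z) ->
    Gamma beta h.

(* The continuous metric phi^2 g_beta; functions on the Klein bottle are
   Gamma-invariant functions on the plane. *)
Record conformal_metric (beta : R) := ConformalMetric {
  phi :> C -> R;
  phi_pos : forall z : C, 0 < phi z;
  phi_cont : forall z : C, continuous phi z;
  phi_inv : forall f : C -> C, Gamma beta f -> forall z : C, phi (f z) = phi z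
}.

(* [0,PI] x [0,beta] is a fundamental domain of Gamma. *)
Definition vol (beta : R) (g : conformal_metric beta) : R :=
  RInt (fun x => RInt (fun y => (phi beta g (x, y)) ^ 2) 0 beta) 0 PI.

(* ** Curves, parametrized by [0,1] *)

(* e is a C^1 extension of c beyond the closed interval [a,b] *)
Definition C1_on (c : R -> C) (a b : R) : Prop :=
  exists e d : R -> C,
    (forall s : R, @is_derive R_AbsRing C_R_NormedModule e s (d s)) /\
    (forall s : R, continuous d s) /\
    (forall s : R, a <= s <= b -> c s = e s).

Definition piecewise_C1 (c : R -> C) : Prop :=
  exists (n : nat) (u : nat -> R),
    u O = 0 /\ u n = 1 /\
    forall i : nat, (i < n)%nat -> u i < u (S i) /\ C1_on c (u i) (u (S i)).

Definition speed (c : R -> C) (s : R) : R :=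
  Cmod (Derive (fun r => fst (c r)) s, Derive (fun r => snd (c r)) s).

Definition curve_length (beta : R) (g : conformal_metric beta) (c : R -> C) : R :=
  RInt (fun s => phi beta g (c s) * speed c s) 0 1.

(* c is a lift to the plane of a closed curve of the Klein bottle in the free
   homotopy class of f in Gamma = pi_1(K): c 1 = (h f h^-1) (c 0) for some
   deck transformation h, where z = h^-1 (c 0). *)
Definition lifts_free_class (beta : R) (f : C -> C) (c : R -> C) : Prop :=
  exists (h : C -> C) (z : C), Gamma beta h /\ c 0 = h z /\ c 1 = h (f z).

Definition least_length (beta : R) (g : conformal_metric beta) (f : C -> C) : R :=
  real (Glb_Rbar (fun L => exists c : R -> C,
    piecewise_C1 c /\ lifts_free_class beta f c /\ L = curve_length beta g c)).

Definition l_sigma (beta : R) (g : conformal_metric beta) : R :=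
  least_length beta g sigma.

Definition l_v (beta : R) (g : conformal_metric beta) : R :=
  least_length beta g (t beta).

(* ** Spherical and flat-spherical metrics *)

Definition dx (f : C -> R) (w : C) : R := Derive (fun x => f (x, snd w)) (fst w).
Definition dy (f : C -> R) (w : C) : R := Derive (fun y => f (fst w, y)) (snd w).

Definition smooth_at (f : C -> R) (w : C) : Prop :=
  forall n : nat, ex_diff_n (fun x y => f (x, y)) n (fst w) (snd w).

(* At w, the map (f1,f2,f3) is smooth and pulls the Euclidean metric of R^3 back
   to the metric lambda^2 g, where g = phi^2 (dx^2 + dy^2). *)
Definition isometric_at (beta lambda : R) (g : conformal_metric beta)
    (f1 f2 f3 : C -> R) (w : C) : Prop :=
  smooth_at f1 w /\ smooth_at f2 w /\ smooth_at f3 w /\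
  dx f1 w ^ 2 + dx f2 w ^ 2 + dx f3 w ^ 2 = (lambda * phi beta g w) ^ 2 /\
  dy f1 w ^ 2 + dy f2 w ^ 2 + dy f3 w ^ 2 = (lambda * phi beta g w) ^ 2 /\
  dx f1 w * dy f1 w + dx f2 w * dy f2 w + dx f3 w * dy f3 w = 0.

Definition round_near (beta lambda : R) (g : conformal_metric beta) (z : C) : Prop :=
  exists f1 f2 f3 : C -> R,
    locally z (fun w : C => isometric_at beta lambda g f1 f2 f3 w /\
                            f1 w ^ 2 + f2 w ^ 2 + f3 w ^ 2 = 1).

(* the Euclidean plane as the plane f3 = 0 of R^3 *)
Definition flat_near (beta lambda : R) (g : conformal_metric beta) (z : C) : Prop :=
  exists f1 f2 : C -> R,
    locally z (fun w : C => isometric_at beta lambda g f1 f2 (fun _ => 0) w).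

(* z lies over none of the curves of the Klein bottle with lifts in the list cs *)
Definition off_curves (beta : R) (cs : list (R -> C)) (z : C) : Prop :=
  ~ exists (c : R -> C) (h : C -> C) (s : R),
      List.In c cs /\ Gamma beta h /\ 0 <= s <= 1 /\ z = h (c s).

(* The singular curves must be piecewise C^1: merely continuous ones could fill
   the surface and void the condition. *)
Definition spherical (beta : R) (g : conformal_metric beta) : Prop :=
  exists (lambda : R) (cs : list (R -> C)),
    0 < lambda /\ List.Forall piecewise_C1 cs /\
    forall z : C, off_curves beta cs z -> round_near beta lambda g z.

Definition flat_spherical (beta : R) (g : conformal_metric beta) : Prop :=
  exists (lambda : R) (cs : list (R -> C)),
    0 < lambda /\ List.Forall piecewise_C1 cs /\
    (forall z : C, off_curves beta cs z ->
       round_near beta lambda g z \/ flat_near beta lambda g z) /\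
    (exists z : C, off_curves beta cs z /\ round_near beta lambda g z) /\
    (exists z : C, off_curves beta cs z /\ flat_near beta lambda g z).

(* Main.v *)
Require Import Defs.
From Stdlib Require Import Reals List.
From Coquelicot Require Import Coquelicot.
From Stdlib Require Import Lra Lia ZArith FunctionalExtensionality.
Open Scope R_scope.

(* Averaging a conformal factor over the horizontal translations lowers the
   area (Cauchy-Schwarz) and does not shorten the curves, so only a profile F(y),
   even and of period beta, matters.  In the Mercator chart of the round sphere the
   half great circles, tanh y = p sin s, lie in the class of sigma.  By Archimedes'
   theorem they fill, with suitable weights, the annuli |y| <= Y uniformly, which
   bounds the integral of F / cosh over each annulus below by a multiple of
   l_sigma.  The extremal profile is 1 / cosh y for |y| <= Y and 1 / cosh Y
   beyond; 1 / cosh y - c is a positive superposition of such annuli as long as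
   c cosh Y <= 1, the constant c being accounted for by the vertical curves.
   Cauchy-Schwarz against the extremal profile then gives 2 c l_v l_sigma <= vol,
   where c is chosen so that both families have the same total mass.  Conversely
   the extremal metric dominates the round sphere, on which a curve joining
   antipodal points has length at least pi. *)

(* Equalities of integrals are typed in a normed module convertible to R, which
   ring and field do not recognize. *)
Ltac eqR := match goal with |- @eq _ ?a ?b => change (@eq R a b) end.

(** The constants come from a splitting of the extremal density. On [0, [Y]] it is (1 / cosh - c) +
    c: half great circles carry the first term, vertical curves of weight c the second. Beyond [Y]
    only vertical curves remain, so the density there must be the constant c; hence c cosh Y = 1,
    unless [Y] = beta / 2 and there is no such region. The last estimate compares the arithmetic and
    geometric means of the two contributions. It is sharp only when they are equal, and this balance
    is one equation between [Y] and c. Let w be the latitude at height [Y]: tanh Y = sin w and cosh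
    Y = 1 / cos w. For [Y] = beta / 2 the balance gives c = sin w / (2 w), and the constraint c cosh
    Y <= 1 becomes tan w <= 2 w, that is w <= b0. For larger beta that choice is inadmissible; then
    c = cos w, and the balance is the equation of omega. The bound is 1 / (2 c) in both cases. *)

Lemma continuity_2d_pt_comp (f g1 g2 : R -> R -> R) (x y : R) :
  continuity_2d_pt f (g1 x y) (g2 x y) ->
  continuity_2d_pt g1 x y -> continuity_2d_pt g2 x y ->
  continuity_2d_pt (fun u v => f (g1 u v) (g2 u v)) x y.
Proof.
intros Hf H1 H2.
apply continuity_2d_pt_filterlim in Hf.
apply continuity_2d_pt_filterlim in H1.
apply continuity_2d_pt_filterlim in H2.
apply continuity_2d_pt_filterlim.
apply (filterlim_comp _ _ _ (fun z : R * R => (g1 (fst z) (snd z), g2 (fst z) (snd z)))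
  (fun z => f (fst z) (snd z)) _ (locally (g1 x y, g2 x y))); [|exact Hf].
intros P [d Hd].
specialize (H1 _ (locally_ball (g1 x y) d)).
specialize (H2 _ (locally_ball (g2 x y) d)).
unfold filtermap in *.
generalize (filter_and _ _ H1 H2).
apply filter_imp. intros [u v] [A B]. apply Hd. split; assumption.
Qed.

Lemma continuity_2d_pt_section1 (f : R -> R -> R) (x y : R) :
  continuity_2d_pt f x y -> continuous (fun u => f u y) x.
Proof.
intros H. apply continuity_2d_pt_filterlim in H.
apply (filterlim_comp _ _ _ (fun u : R => (u, y)) (fun z => f (fst z) (snd z)) _ (locally (x, y))); [|exact H].
intros P [d Hd]. exists d. intros u Hu. apply Hd. split; [exact Hu | apply ball_center].
Qed.

Lemma continuity_2d_pt_section2 (f : R -> R -> R) (x y : R) :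
  continuity_2d_pt f x y -> continuous (f x) y.
Proof.
intros H. apply continuity_2d_pt_filterlim in H.
apply (filterlim_comp _ _ _ (fun v : R => (x, v)) (fun z => f (fst z) (snd z)) _ (locally (x, y))); [|exact H].
intros P [d Hd]. exists d. intros u Hu. apply Hd. split; [apply ball_center|exact Hu].
Qed.

Lemma continuity_2d_pt_of1 (f : R -> R) (x y : R) :
  continuous f x -> continuity_2d_pt (fun u _ => f u) x y.
Proof.
intros H. apply (continuity_1d_2d_pt_comp f (fun u _ => u)).
apply continuity_pt_filterlim, H. apply continuity_2d_pt_id1.
Qed.

Lemma continuity_2d_pt_of2 (f : R -> R) (x y : R) :
  continuous f y -> continuity_2d_pt (fun _ v => f v) x y.
Proof.
intros H. apply (continuity_1d_2d_pt_comp f (fun _ v => v)).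
apply continuity_pt_filterlim, H. apply continuity_2d_pt_id2.
Qed.

Lemma is_derive_continuous (f : R -> R) (x l : R) :
  is_derive f x l -> continuous f x.
Proof. intros H. apply (ex_derive_continuous f x). exists l. exact H. Qed.

Lemma RInt_eq (f g : R -> R) (a b : R) :
  (forall x, Rmin a b < x < Rmax a b -> f x = g x) -> RInt f a b = RInt g a b.
Proof. exact (RInt_ext (V := R_CompleteNormedModule) f g a b). Qed.

Lemma RInt_zero (a b : R) : RInt (fun _ => 0) a b = 0.
Proof. rewrite RInt_const. apply Rmult_0_r. Qed.

Lemma Derive_eta (f : R -> R) (x l : R) :
  is_derive f x l -> Derive (fun t : R => f t) x = l.
Proof. apply is_derive_unique. Qed.

Lemma ex_RInt_cont (f : R -> R) (a b : R) :
  (forall x, continuous f x) -> ex_RInt f a b.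
Proof. intros H. apply (ex_RInt_continuous (V := R_CompleteNormedModule)). intros; apply H. Qed.

(** * Integrals depending on a parameter and the order of integration *)

Lemma continuous_RInt_param (f : R -> R -> R) (a b : R) :
  (forall x y, continuity_2d_pt f x y) ->
  forall x, continuous (fun u => RInt (f u) a b) x.
Proof.
intros Hf x.
assert (Hs : forall u, forall t, continuous (f u) t)
  by (intros; apply continuity_2d_pt_section2, Hf).
assert (W : forall a b, a <= b -> continuous (fun u => RInt (f u) a b) x).
{ clear a b. intros a b Hab. apply filterlim_locally. intros eps.
  assert (He : 0 < eps / (b - a + 1)) by (apply Rdiv_lt_0_compat; [apply cond_pos|lra]).
  destruct (uniform_continuity_2d f (x - 1) (x + 1) a b (fun u v _ _ => Hf u v) (mkposreal _ He))
    as [d Hd].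
  assert (Hd1 : 0 < Rmin d 1) by (apply Rmin_pos; [apply cond_pos | lra]).
  exists (mkposreal _ Hd1). intros u Hu.
  change (Rabs (u - x) < Rmin d 1) in Hu.
  assert (Hu1 := Rlt_le_trans _ _ _ Hu (Rmin_l _ _)).
  assert (Hu2 := Rlt_le_trans _ _ _ Hu (Rmin_r _ _)).
  change (Rabs (RInt (f u) a b - RInt (f x) a b) < eps).
  assert (E : RInt (fun t => f u t - f x t) a b = RInt (f u) a b - RInt (f x) a b).
  { apply (RInt_minus (V := R_CompleteNormedModule) (f u) (f x)); apply ex_RInt_cont; intros; apply Hs. }
  rewrite <- E.
  apply Rle_lt_trans with ((b - a) * (eps / (b - a + 1))).
  - apply abs_RInt_le_const; [exact Hab| |].
    + apply ex_RInt_cont. intros t.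
      apply (continuous_minus (V := R_NormedModule) (f u) (f x)); apply Hs.
    + intros t Ht. left. apply Rabs_def2 in Hu2.
      apply (Hd x t u t); try lra.
      rewrite Rminus_diag, Rabs_R0. apply cond_pos.
  - assert (0 < eps) by apply cond_pos.
    apply Rmult_lt_reg_r with (b - a + 1); [lra|]. field_simplify; nra. }
destruct (Rle_dec a b) as [Hab|Hab]; [apply W, Hab|].
apply (continuous_ext (fun u => opp (RInt (f u) b a))).
{ intros u. apply (opp_RInt_swap (V := R_CompleteNormedModule) (f u)). apply ex_RInt_cont, Hs. }
apply (continuous_opp (V := R_NormedModule)). apply W. lra.
Qed.

Lemma is_derive_RInt_cont (f : R -> R) (a x : R) :
  (forall t, continuous f t) -> is_derive (RInt f a) x (f x).
Proof.
intros H. apply (is_derive_RInt (V := R_NormedModule) f (RInt f a) a); [|apply H].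
apply filter_forall. intros b.
apply (RInt_correct (V := R_CompleteNormedModule)). apply ex_RInt_cont, H.
Qed.

Lemma RInt_of_derive (f df : R -> R) (a b : R) :
  (forall x, Rmin a b <= x <= Rmax a b -> is_derive f x (df x)) ->
  (forall x, Rmin a b <= x <= Rmax a b -> continuous df x) ->
  RInt df a b = f b - f a.
Proof. intros H1 H2. apply is_RInt_unique. exact (is_RInt_derive (V := R_CompleteNormedModule) f df a b H1 H2). Qed.

(** As functions of the upper limit [b], both sides have the same derivative, by differentiation
    under the integral sign, and both vanish at [a]. *)
Lemma RInt_fubini (f : R -> R -> R) (a b c d : R) :
  (forall x y, continuity_2d_pt f x y) ->
  RInt (fun x => RInt (fun y => f x y) c d) a b =
  RInt (fun y => RInt (fun x => f x y) a b) c d.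
Proof.
intros Hf.
assert (Hf' : forall x y, continuity_2d_pt (fun y x => f x y) x y).
{ intros x y. apply (continuity_2d_pt_comp f (fun _ v => v) (fun u _ => u)).
  apply Hf. apply continuity_2d_pt_id2. apply continuity_2d_pt_id1. }
set (P := fun X => RInt (fun y => RInt (fun x => f x y) a X) c d).
assert (HP : forall X, is_derive P X (RInt (fun y => f X y) c d)).
{ intros X. unfold P.
  assert (D : forall u v, Derive (fun z => RInt (fun x => f x v) a z) u = f u v).
  { intros u v. apply is_derive_unique, (is_derive_RInt_cont (fun x => f x v)).
    intros t. apply (continuity_2d_pt_section1 f t v), Hf. }
  replace (RInt (fun y => f X y) c d)
    with (RInt (fun y => Derive (fun z => RInt (fun x => f x y) a z) X) c d)
    by (apply RInt_ext; intros; apply D).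
  apply (is_derive_RInt_param (fun z y => RInt (fun x => f x y) a z)).
  - apply filter_forall. intros z y _. eexists. apply (is_derive_RInt_cont (fun x => f x y)).
    intros t. apply (continuity_2d_pt_section1 f t y), Hf.
  - intros y _. apply continuity_2d_pt_ext with f; [intros; symmetry; apply D|apply Hf].
  - apply filter_forall. intros z. apply ex_RInt_cont.
    apply (continuous_RInt_param (fun y x => f x y)). exact Hf'. }
transitivity (P b - P a).
- apply RInt_of_derive; intros; [apply HP|].
  apply continuous_RInt_param, Hf.
- unfold P.
  assert (Z : RInt (fun y => RInt (fun x => f x y) a a) c d = 0).
  { transitivity (RInt (fun _ => 0) c d); [|apply RInt_zero]. apply RInt_eq. intros. apply (RInt_point (V := R_CompleteNormedModule)). }
  rewrite Z. apply Rminus_0_r.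
Qed.

(** The mean value theorem for the primitive of [h] minus [f]. Only [h] is integrated, so [df] may
    be the derivative of a function along a curve, about which nothing but a bound is known. *)
Lemma increment_le_RInt (f df h : R -> R) (a b : R) :
  a <= b ->
  (forall x, a <= x <= b -> is_derive f x (df x)) ->
  (forall x, continuous h x) ->
  (forall x, a <= x <= b -> df x <= h x) ->
  f b - f a <= RInt h a b.
Proof.
intros Hab Hf Hh Hle.
assert (Hd : forall x, a <= x <= b -> is_derive (fun x => RInt h a x - f x) x (h x - df x)).
{ intros x Hx. apply (is_derive_minus (V := R_NormedModule) (RInt h a) f); [apply is_derive_RInt_cont, Hh|apply Hf, Hx]. }
destruct (MVT_gen (fun x => RInt h a x - f x) a b (fun x => h x - df x)) as [c [Hc E]].
- rewrite Rmin_left, Rmax_right by lra. intros x Hx. apply Hd. lra.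
- rewrite Rmin_left, Rmax_right by lra. intros x Hx.
  apply continuity_pt_filterlim. exact (is_derive_continuous (fun x => RInt h a x - f x) x _ (Hd x Hx)).
- rewrite Rmin_left, Rmax_right in Hc by lra.
  rewrite RInt_point in E. change zero with 0 in E.
  assert (0 <= (h c - df c) * (b - a)); [|lra].
  apply Rmult_le_pos; [|lra]. specialize (Hle c Hc). lra.
Qed.

(** * Archimedes' theorem *)

Lemma sin_sq_lt_1 (a : R) : - (PI / 2) < a < PI / 2 -> sin a ^ 2 < 1.
Proof.
intros Ha. assert (0 < cos a) by (apply cos_gt_0; lra).
generalize (sin2_cos2 a). unfold Rsqr. nra.
Qed.

Lemma sin_mul_sin_sq_lt_1 (a s : R) :
  - (PI / 2) < a < PI / 2 -> (sin a * sin s) ^ 2 < 1.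
Proof.
intros Ha. generalize (sin_sq_lt_1 a Ha). generalize (sin2_cos2 s). unfold Rsqr. nra.
Qed.

Section Archimedes.

Variable h : R -> R.
Hypothesis Hh : forall z, continuous h z.

(** The primitive starts at the pole z = 1, so that [psi] stays bounded there in spite of its
    denominator. *)
Let Phi := RInt h 1.
Let psi z := Phi z / (1 - z ^ 2).
Let dpsi z := h z / (1 - z ^ 2) + 2 * z * Phi z / (1 - z ^ 2) ^ 2.

Let DPhi z : is_derive Phi z (h z).
Proof. apply is_derive_RInt_cont, Hh. Qed.

Let Dpsi z : z ^ 2 < 1 -> is_derive psi z (dpsi z).
Proof.
intros Hz. unfold psi, dpsi. auto_derive.
- repeat split. now exists (h z); apply DPhi. lra.
- rewrite (Derive_eta _ _ _ (DPhi z)). field. lra.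
Qed.

Let Cinv z : z ^ 2 < 1 -> continuous (fun z => / (1 - z ^ 2)) z.
Proof.
intros Hz. apply (ex_derive_continuous (fun z => / (1 - z ^ 2))). auto_derive. lra.
Qed.

Let Cdpsi z : z ^ 2 < 1 -> continuous dpsi z.
Proof.
intros Hz.
assert (CPhi := is_derive_continuous _ _ _ (DPhi z)).
apply (continuous_ext (fun z => plus (mult (h z) (/ (1 - z ^ 2)))
   (mult (mult (2 * z) (Phi z)) (mult (/ (1 - z ^ 2)) (/ (1 - z ^ 2)))))).
{ intros t. unfold dpsi, plus, mult; simpl. unfold Rdiv. f_equal. f_equal.
  rewrite <- Rinv_mult. f_equal. ring. }
apply (continuous_plus (V := R_NormedModule)).
- apply (continuous_mult (K := R_AbsRing)); [apply Hh|apply Cinv, Hz].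
- repeat apply (continuous_mult (K := R_AbsRing)); try apply Cinv, Hz; try exact CPhi.
  apply (continuous_const (V := R_UniformSpace)). apply continuous_id.
Qed.

Let Q a s := sin a * cos a * psi (sin a * sin s) * sin s.
Let dQ a s := sin s * ((cos a ^ 2 - sin a ^ 2) * psi (sin a * sin s)
  + sin a * cos a * (dpsi (sin a * sin s) * (cos a * sin s))).
Let dP a s := - sin s * psi (sin a * sin s) + cos s * (dpsi (sin a * sin s) * (sin a * cos s)).

Let D_Q a s : - (PI / 2) < a < PI / 2 -> is_derive (fun a => Q a s) a (dQ a s).
Proof.
intros Ha. unfold Q, dQ.
assert (Hz := sin_mul_sin_sq_lt_1 a s Ha).
auto_derive.
- repeat split. now exists (dpsi (sin a * sin s)); apply Dpsi.
- rewrite (Derive_eta _ _ _ (Dpsi _ Hz)). ring.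
Qed.

Let D_P a s : - (PI / 2) < a < PI / 2 ->
  is_derive (fun s => psi (sin a * sin s) * cos s) s (dP a s).
Proof.
intros Ha. unfold dP.
assert (Hz := sin_mul_sin_sq_lt_1 a s Ha).
auto_derive.
- repeat split. now exists (dpsi (sin a * sin s)); apply Dpsi.
- rewrite (Derive_eta _ _ _ (Dpsi _ Hz)). ring.
Qed.

(** On the unit sphere |grad z|^2 = 1 - z^2 and the Laplacian of z is -2 z, so the divergence of psi
    grad z is the derivative of (1 - z^2) psi, which is h. The proof checks this in coordinates by
    eliminating the cosines. *)
Let dQ_dP a s : - (PI / 2) < a < PI / 2 -> dQ a s = sin a * h (sin a * sin s) - dP a s.
Proof.
intros Ha. assert (Hz := sin_mul_sin_sq_lt_1 a s Ha).
unfold dQ, dP, dpsi, psi.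
assert (Ca : cos a ^ 2 = 1 - sin a ^ 2) by (generalize (sin2_cos2 a); unfold Rsqr; lra).
assert (Cs : cos s ^ 2 = 1 - sin s ^ 2) by (generalize (sin2_cos2 s); unfold Rsqr; lra).
set (z := sin a * sin s) in *.
transitivity (sin s * ((1 - 2 * sin a ^ 2) * (Phi z / (1 - z ^ 2)))
   + sin a * (cos a ^ 2) * sin s ^ 2 * (h z / (1 - z ^ 2) + 2 * z * Phi z / (1 - z ^ 2) ^ 2)).
{ transitivity (sin s * ((cos a ^ 2 - sin a ^ 2) * (Phi z / (1 - z ^ 2)))
   + sin a * (cos a ^ 2) * sin s ^ 2 * (h z / (1 - z ^ 2) + 2 * z * Phi z / (1 - z ^ 2) ^ 2)); [ring|].
  rewrite Ca. ring. }
transitivity (sin a * h z + sin s * (Phi z / (1 - z ^ 2)) - sin a * cos s ^ 2 *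
  (h z / (1 - z ^ 2) + 2 * z * Phi z / (1 - z ^ 2) ^ 2)); [|ring].
rewrite Ca, Cs. 
replace (sin a * (1 - sin a ^ 2) * sin s ^ 2) with (sin a * (1 - z ^ 2) - sin a * (1 - sin s ^ 2))
  by (unfold z; ring).
replace (sin s * ((1 - 2 * sin a ^ 2) * (Phi z / (1 - z ^ 2))))
  with (sin s * (Phi z / (1 - z ^ 2)) - sin a * 2 * z * (Phi z / (1 - z ^ 2))) by (unfold z; ring).
field. lra.
Qed.

Let C2_z a s : continuity_2d_pt (fun a s => sin a * sin s) a s.
Proof.
apply continuity_2d_pt_mult; [apply (continuity_2d_pt_of1 sin)|apply (continuity_2d_pt_of2 sin)]; apply continuous_sin.
Qed.

Let C2_dQ a s : - (PI / 2) < a < PI / 2 -> continuity_2d_pt dQ a s.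
Proof.
intros Ha. assert (Hz := sin_mul_sin_sq_lt_1 a s Ha).
assert (Sa : continuity_2d_pt (fun a _ => sin a) a s) by apply (continuity_2d_pt_of1 sin), continuous_sin.
assert (Ca : continuity_2d_pt (fun a _ => cos a) a s) by apply (continuity_2d_pt_of1 cos), continuous_cos.
assert (Ss : continuity_2d_pt (fun _ s => sin s) a s) by apply (continuity_2d_pt_of2 sin), continuous_sin.
assert (P1 : continuity_2d_pt (fun a s => psi (sin a * sin s)) a s).
{ apply (continuity_1d_2d_pt_comp psi); [|apply C2_z].
  apply continuity_pt_filterlim. exact (is_derive_continuous _ _ _ (Dpsi _ Hz)). }
assert (P2 : continuity_2d_pt (fun a s => dpsi (sin a * sin s)) a s).
{ apply (continuity_1d_2d_pt_comp dpsi); [|apply C2_z].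
  apply continuity_pt_filterlim. exact (Cdpsi _ Hz). }
unfold dQ. simpl.
repeat first [ assumption | apply continuity_2d_pt_mult | apply continuity_2d_pt_plus | apply continuity_2d_pt_opp
  | apply continuity_2d_pt_const].
Qed.

(** Flux of the field through the arc of constant [a] in the octant. *)
Let T a := RInt (Q a) 0 (PI / 2).

Let near_a a : - (PI / 2) < a < PI / 2 -> locally a (fun u => - (PI / 2) < u < PI / 2).
Proof.
intros [H1 H2]. apply filter_and; [exact (open_gt _ a H1)|exact (open_lt _ a H2)].
Qed.

(** The divergence identity integrated in s. The boundary term at s = PI / 2 vanishes with cos s;
    the one at s = 0 is psi 0 = - RInt h 0 1. *)
Let D_T a : - (PI / 2) < a < PI / 2 ->
  is_derive T a (sin a * RInt (fun s => h (sin a * sin s)) 0 (PI / 2) - RInt h 0 1).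
Proof.
intros Ha.
assert (E : RInt (dQ a) 0 (PI / 2) = sin a * RInt (fun s => h (sin a * sin s)) 0 (PI / 2) - RInt h 0 1).
{ transitivity (RInt (fun s => minus (scal (sin a) (h (sin a * sin s))) (dP a s)) 0 (PI / 2)).
  { apply RInt_ext. intros s _. apply dQ_dP, Ha. }
  assert (Ch : forall s, continuous (fun s => h (sin a * sin s)) s).
  { intros s. apply (continuous_comp (fun s => sin a * sin s) h); [|apply Hh].
    apply (ex_derive_continuous (fun s => sin a * sin s)). auto_derive. trivial. }
  assert (Cp : forall s, continuous (dP a) s).
  { intros s. assert (Hz := sin_mul_sin_sq_lt_1 a s Ha).
    apply (continuous_ext (fun s => minus (scal (sin a) (h (sin a * sin s))) (dQ a s))).
    { intros t. rewrite (dQ_dP a t Ha). unfold minus, plus, opp, scal; simpl. unfold mult; simpl. ring. }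
    apply (continuous_minus (V := R_NormedModule)).
    apply (continuous_scal_r (V := R_NormedModule)), Ch.
    apply continuity_2d_pt_section2, C2_dQ, Ha. }
  rewrite (RInt_minus (V := R_CompleteNormedModule)).
  - rewrite (RInt_scal (V := R_CompleteNormedModule)) by apply ex_RInt_cont, Ch.
    rewrite (RInt_of_derive (fun s => psi (sin a * sin s) * cos s) (dP a)) by (intros; first [apply D_P, Ha | apply Cp]).
    rewrite cos_PI2, cos_0, sin_0, Rmult_0_r.
    assert (psi 0 = - RInt h 0 1).
    { unfold psi, Phi. rewrite <- (opp_RInt_swap (V := R_CompleteNormedModule) h 0 1) by apply ex_RInt_cont, Hh.
      unfold opp; simpl. field. }
    unfold minus, plus, opp, scal; simpl; unfold mult; simpl. rewrite Rmult_0_r, H. ring.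
  - apply ex_RInt_cont. intros s. apply (continuous_scal_r (V := R_NormedModule)), Ch.
  - apply ex_RInt_cont, Cp. }
rewrite <- E.
assert (DQ : forall u v, - (PI / 2) < u < PI / 2 -> Derive (fun z => Q z v) u = dQ u v).
{ intros. apply is_derive_unique, D_Q. assumption. }
replace (RInt (dQ a) 0 (PI / 2)) with (RInt (fun t => Derive (fun u => Q u t) a) 0 (PI / 2))
  by (apply RInt_ext; intros; apply DQ, Ha).
apply (is_derive_RInt_param Q).
- generalize (near_a a Ha). apply filter_imp. intros u Hu t _. eexists. apply D_Q, Hu.
- intros t _. apply continuity_2d_pt_ext_loc with dQ; [|apply C2_dQ, Ha].
  destruct (near_a a Ha) as [d Hd]. exists d. intros u v Hu _. symmetry. apply DQ. apply Hd, Hu.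
- generalize (near_a a Ha). apply filter_imp. intros u Hu. apply ex_RInt_cont. intros s.
  assert (Hz := sin_mul_sin_sq_lt_1 u s Hu).
  apply (continuous_mult (K := R_AbsRing) (fun s => sin u * cos u * psi (sin u * sin s)) sin);
    [|apply continuous_sin].
  apply (continuous_scal_r (V := R_NormedModule) (sin u * cos u) (fun s => psi (sin u * sin s))).
  apply (continuous_comp (fun s => sin u * sin s) psi).
  + apply (ex_derive_continuous (fun s => sin u * sin s)). auto_derive. trivial.
  + exact (is_derive_continuous _ _ _ (Dpsi _ Hz)).
Qed.

(** The flux dies out at a = PI / 2: on [0, 1[ the primitive [Phi] is at most (1 - z) max |h|, and 1
    - z divides 1 - z^2, so [psi] is bounded and the factor cos a of [Q] decides. *)
Let T_small : exists B, 0 <= B /\ forall a, 0 <= a < PI / 2 -> T a <= B * cos a.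
Proof.
destruct (continuity_ab_maj (fun z => Rabs (h z)) 0 1) as [zm [Hm _]]; [lra| |].
{ intros c _. apply continuity_pt_filterlim.
  apply (continuous_comp h Rabs); [apply Hh|apply continuous_Rabs]. }
set (B := Rabs (h zm)).
assert (HB : 0 <= B) by apply Rabs_pos.
exists (PI / 2 * B). split; [generalize PI_RGT_0; nra|].
intros a Ha.
assert (Ha' : - (PI / 2) < a < PI / 2) by lra.
assert (0 < cos a) by (apply cos_gt_0; lra).
assert (0 <= sin a) by (apply sin_ge_0; lra).
assert (sin a <= 1) by apply SIN_bound.
replace (PI / 2 * B * cos a) with ((PI / 2 - 0) * (B * cos a)) by ring.
apply Rle_trans with (1 := Rle_abs _).
apply abs_RInt_le_const; [lra| |].
- apply ex_RInt_cont. intros s.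
  assert (Hz := sin_mul_sin_sq_lt_1 a s Ha').
  apply (continuous_mult (K := R_AbsRing) (fun s => sin a * cos a * psi (sin a * sin s)) sin);
    [|apply continuous_sin].
  apply (continuous_scal_r (V := R_NormedModule) (sin a * cos a) (fun s => psi (sin a * sin s))).
  apply (continuous_comp (fun s => sin a * sin s) psi).
  + apply (ex_derive_continuous (fun s => sin a * sin s)). auto_derive. trivial.
  + exact (is_derive_continuous _ _ _ (Dpsi _ Hz)).
- intros s Hs.
  assert (Hz := sin_mul_sin_sq_lt_1 a s Ha').
  assert (0 <= sin s) by (apply sin_ge_0; lra).
  assert (sin s <= 1) by apply SIN_bound.
  set (z := sin a * sin s) in *.
  assert (Hz0 : 0 <= z) by (apply Rmult_le_pos; assumption).
  assert (Hz1 : z < 1) by nra.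
  assert (Hpsi : Rabs (psi z) <= B).
  { unfold psi. rewrite Rabs_div by lra. rewrite (Rabs_right (1 - z ^ 2)) by lra.
    apply Rle_div_l; [lra|].
    unfold Phi. rewrite <- (opp_RInt_swap (V := R_CompleteNormedModule) h z 1) by apply ex_RInt_cont, Hh.
    change (Rabs (- RInt h z 1) <= B * (1 - z ^ 2)). rewrite Rabs_Ropp.
    apply Rle_trans with ((1 - z) * B).
    - apply abs_RInt_le_const; [lra|apply ex_RInt_cont, Hh|]. intros t Ht. apply Hm. lra.
    - assert (0 <= B * ((1 - z) * z)) by (repeat apply Rmult_le_pos; lra). lra. }
  unfold Q. fold z.
  rewrite !Rabs_mult, (Rabs_right (sin a)), (Rabs_right (cos a)), (Rabs_right (sin s)) by lra.
  assert (0 <= Rabs (psi z)) by apply Rabs_pos.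
  apply Rle_trans with (1 * cos a * B * 1); [|lra].
  repeat apply Rmult_le_compat; try lra; repeat apply Rmult_le_pos; lra.
Qed.

Let D_lin (f : R -> R) (I K x l : R) :
  is_derive f x l -> is_derive (fun a => f a + I * a + K * cos a) x (l + I - K * sin x).
Proof.
intros D. auto_derive; [exact (ex_intro _ _ D)|].
rewrite (Derive_eta f x _ D). ring.
Qed.

(* Archimedes' theorem in integrated form: on the unit sphere the height
   z = sin a sin s is equidistributed for the area sin a da ds.  In the chart
   (a, s) the area form times h(z) is the divergence of (Q, P), where
   psi (z) grad z = (Q, P) and (1 - z^2) psi is a primitive of h. *)
Lemma archimedes_lower_bound (K : R) :
  (forall p, 0 <= p < 1 -> K <= RInt (fun s => h (p * sin s)) 0 (PI / 2)) ->
  K <= PI / 2 * RInt h 0 1.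
Proof.
intros HK.
destruct T_small as [B [HB HT]].
set (I := RInt h 0 1).
assert (Hbound : forall a, 0 <= a < PI / 2 -> K <= I * a + (K + B) * cos a).
{ intros a Ha.
  (* This function is nondecreasing: its derivative is sin a times the excess of the arc integral
     over [K]. *)
  assert (M : 0 <= (T a + I * a + K * cos a) - (T 0 + I * 0 + K * cos 0)).
  { destruct (MVT_gen (fun a => T a + I * a + K * cos a) 0 a
      (fun a => (sin a * RInt (fun s => h (sin a * sin s)) 0 (PI / 2) - I) + I - K * sin a)) as [c [Hc E]].
    - rewrite Rmin_left, Rmax_right by lra. intros x Hx.
      assert (Hx' : - (PI / 2) < x < PI / 2) by lra.
      apply D_lin, D_T, Hx'.
    - rewrite Rmin_left, Rmax_right by lra. intros x Hx.
      assert (Hx' : - (PI / 2) < x < PI / 2) by lra.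
      apply continuity_pt_filterlim. exact (is_derive_continuous _ _ _ (D_lin T I K x _ (D_T x Hx'))).
    - rewrite Rmin_left, Rmax_right in Hc by lra. rewrite E.
      assert (0 <= sin c) by (apply sin_ge_0; lra).
      assert (sin c ^ 2 < 1) by (apply sin_sq_lt_1; lra).
      assert (K <= RInt (fun s => h (sin c * sin s)) 0 (PI / 2)) by (apply HK; nra).
      apply Rmult_le_pos; nra. }
  assert (T0 : T 0 = 0).
  { transitivity (RInt (fun _ => 0) 0 (PI / 2)); [|apply RInt_zero]. apply RInt_eq. intros. unfold Q. rewrite sin_0. ring. }
  rewrite T0, cos_0 in M. specialize (HT a Ha). lra. }
assert (HPI := PI_RGT_0).
replace (PI / 2 * I) with (I * (PI / 2) + (K + B) * cos (PI / 2)) by (rewrite cos_PI2; ring).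
(* The limit a -> PI / 2, taken by contradiction: a strict inequality at PI / 2 would persist
   slightly below it. *)
set (f := fun a => I * a + (K + B) * cos a).
apply Rnot_lt_le. intros Hlt.
assert (Cf : continuous f (PI / 2)).
{ apply (ex_derive_continuous f). unfold f. auto_derive. trivial. }
destruct (Cf (fun y => y < K) (open_lt K (f (PI / 2)) Hlt)) as [d Hd].
set (m := Rmin (d / 2) (PI / 2)).
assert (Hd0 := cond_pos d).
assert (0 < m <= d / 2 /\ m <= PI / 2).
{ repeat split. apply Rmin_pos; lra. apply Rmin_l. apply Rmin_r. }
specialize (Hd (PI / 2 - m)). specialize (Hbound (PI / 2 - m)).
assert (f (PI / 2 - m) < K).
{ apply Hd. change (Rabs (PI / 2 - m - PI / 2) < d). apply Rabs_def1; lra. }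
unfold f in *. assert (0 <= PI / 2 - m < PI / 2) by lra. specialize (Hbound H1). lra.
Qed.

End Archimedes.

(** * Hyperbolic functions and the annulus bound *)

Lemma cosh_pos (y : R) : 0 < cosh y.
Proof. unfold cosh. generalize (exp_pos y) (exp_pos (- y)). lra. Qed.

Lemma cosh_sq (y : R) : cosh y ^ 2 = 1 + sinh y ^ 2.
Proof.
unfold cosh, sinh. assert (exp y * exp (- y) = 1) by (rewrite <- exp_plus, Rplus_opp_r; apply exp_0).
nra.
Qed.

Lemma cosh_opp (y : R) : cosh (- y) = cosh y.
Proof. unfold cosh. rewrite Ropp_involutive. lra. Qed.

Lemma sinh_opp (y : R) : sinh (- y) = - sinh y.
Proof. unfold sinh. rewrite Ropp_involutive. lra. Qed.

Lemma tanh_opp (y : R) : tanh (- y) = - tanh y.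
Proof. unfold tanh. rewrite cosh_opp, sinh_opp. unfold Rdiv. ring. Qed.

Lemma sinh_nonneg (y : R) : 0 <= y -> 0 <= sinh y.
Proof. intros [H|<-]; [rewrite <- sinh_0; left; apply sinh_lt, H | rewrite sinh_0; lra]. Qed.

Lemma tanh_0 : tanh 0 = 0.
Proof. unfold tanh. rewrite sinh_0. unfold Rdiv. ring. Qed.

Lemma tanh_sq (y : R) : tanh y ^ 2 = 1 - / cosh y ^ 2.
Proof. unfold tanh. generalize (cosh_pos y) (cosh_sq y). intros H E.
replace ((sinh y / cosh y) ^ 2) with (sinh y ^ 2 / cosh y ^ 2) by (field; lra).
replace (sinh y ^ 2) with (cosh y ^ 2 - 1) by lra. field. lra. Qed.

Lemma tanh_bound (y : R) : -1 < tanh y < 1.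
Proof.
assert (0 < / cosh y ^ 2) by (apply Rinv_0_lt_compat, pow_lt, cosh_pos).
generalize (tanh_sq y). intros; split; nra.
Qed.

Lemma is_derive_tanh (y : R) : is_derive tanh y (/ cosh y ^ 2).
Proof.
unfold tanh. generalize (cosh_pos y) (cosh_sq y). intros H E.
auto_derive; [lra|]. transitivity ((cosh y ^ 2 - sinh y ^ 2) / cosh y ^ 2); [field; lra|].
replace (cosh y ^ 2 - sinh y ^ 2) with 1 by lra. unfold Rdiv. ring.
Qed.

Lemma tanh_pos (y : R) : 0 < y -> 0 < tanh y.
Proof.
intros H. apply Rdiv_lt_0_compat; [|apply cosh_pos]. rewrite <- sinh_0. apply sinh_lt, H.
Qed.

Lemma tanh_lt (a b : R) : a < b -> tanh a < tanh b.
Proof.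
intros H. destruct (MVT_gen tanh a b (fun y => / cosh y ^ 2)) as [c [_ E]].
- intros; apply is_derive_tanh.
- intros x _. apply continuity_pt_filterlim. exact (is_derive_continuous _ _ _ (is_derive_tanh x)).
- assert (0 < / cosh c ^ 2) by (apply Rinv_0_lt_compat, pow_lt, cosh_pos). nra.
Qed.

Lemma tanh_le (a b : R) : a <= b -> tanh a <= tanh b.
Proof. intros [H|<-]; [left; apply tanh_lt, H|right; reflexivity]. Qed.

Lemma is_derive_atan_sinh (y : R) : is_derive (fun y => atan (sinh y)) y (/ cosh y).
Proof.
generalize (cosh_pos y) (cosh_sq y). intros H E. auto_derive; [trivial|].
replace (1 + sinh y * (sinh y * 1)) with (cosh y ^ 2) by lra. field. lra.
Qed.

Lemma continuous_inv_cosh (y : R) : continuous (fun y => / cosh y) y.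
Proof. apply (ex_derive_continuous (fun y => / cosh y)). auto_derive. generalize (cosh_pos y). lra. Qed.

Lemma continuous_inv_cosh_sq (y : R) : continuous (fun y => / cosh y ^ 2) y.
Proof.
apply (ex_derive_continuous (fun y => / cosh y ^ 2)). auto_derive.
generalize (cosh_pos y). intros. apply Rgt_not_eq. nra.
Qed.

Definition artanh (w : R) : R := ln ((1 + w) / (1 - w)) / 2.

Lemma artanh_opp (w : R) : -1 < w < 1 -> artanh (- w) = - artanh w.
Proof.
intros H. unfold artanh. replace ((1 + - w) / (1 - - w)) with (/ ((1 + w) / (1 - w))) by (field; lra).
rewrite ln_Rinv; [lra|]. apply Rdiv_lt_0_compat; lra.
Qed.

Lemma exp_2_artanh (w : R) : -1 < w < 1 -> exp (artanh w) ^ 2 = (1 + w) / (1 - w).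
Proof.
intros H. simpl. rewrite Rmult_1_r, <- exp_plus. unfold artanh.
replace (ln ((1 + w) / (1 - w)) / 2 + ln ((1 + w) / (1 - w)) / 2) with (ln ((1 + w) / (1 - w))) by field.
apply exp_ln, Rdiv_lt_0_compat; lra.
Qed.

Lemma tanh_artanh (w : R) : -1 < w < 1 -> tanh (artanh w) = w.
Proof.
intros H. unfold tanh, sinh, cosh. rewrite exp_Ropp.
assert (E := exp_2_artanh w H). assert (P := exp_pos (artanh w)).
set (e := exp (artanh w)) in *.
assert (E' : e ^ 2 * (1 - w) = 1 + w) by (rewrite E; field; lra).
assert (0 < e ^ 2) by (apply pow_lt, P).
field_simplify_eq; [|lra]. lra.
Qed.

Lemma tanh_inj (a b : R) : tanh a = tanh b -> a = b.
Proof.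
intros E. destruct (Rtotal_order a b) as [H|[H|H]]; [|exact H|]; apply tanh_lt in H; lra.
Qed.

Lemma artanh_tanh (y : R) : artanh (tanh y) = y.
Proof. apply tanh_inj, tanh_artanh, tanh_bound. Qed.

Lemma inv_cosh_artanh (w : R) : -1 < w < 1 -> / cosh (artanh w) = sqrt (1 - w ^ 2).
Proof.
intros H. assert (C := cosh_pos (artanh w)).
rewrite <- (tanh_artanh w H) at 2. rewrite tanh_sq.
replace (1 - (1 - / cosh (artanh w) ^ 2)) with ((/ cosh (artanh w)) ^ 2) by (field; lra).
rewrite sqrt_pow2; [reflexivity|]. left. apply Rinv_0_lt_compat, C.
Qed.

Lemma is_derive_artanh (w : R) : -1 < w < 1 -> is_derive artanh w (/ (1 - w ^ 2)).
Proof.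
intros H. unfold artanh. auto_derive.
- split; [lra|split; [|trivial]]. apply Rmult_lt_0_compat; [lra|]. apply Rinv_0_lt_compat; lra.
- field. repeat split; nra.
Qed.

(* The integral in the hypothesis is half the length of the half great circle
   tanh y = p sin s for the metric F(y) |dz|; the conclusion is
   the area bound of Pu type for the annulus between the equator and [y]. *)
Lemma area_bound_annulus (F : R -> R) (L : R) :
  (forall y, continuous F y) ->
  (forall p, 0 <= p < 1 ->
     L <= RInt (fun s => F (artanh (p * sin s)) / sqrt (1 - (p * sin s) ^ 2)) 0 (PI / 2)) ->
  forall y, 0 < y -> 2 / PI * L * tanh y <= RInt (fun u => F u / cosh u) 0 y.
Proof.
intros CF HL y Hy.
set (r := tanh y).
assert (Hr : 0 < r < 1) by (split; [apply tanh_pos, Hy|apply tanh_bound]).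
set (H := fun w => F (artanh w) / sqrt (1 - w ^ 2)).
(* Projection onto [-1, 1]. Archimedes' theorem asks for a function continuous on the whole line,
   while [H] is known to be continuous only on ]-1, 1[; the factor r < 1 keeps its argument away
   from the poles. *)
set (clamp := fun z => (Rabs (z + 1) - Rabs (z - 1)) / 2).
assert (clamp_id : forall z, -1 <= z <= 1 -> clamp z = z).
{ intros z Hz. unfold clamp. rewrite Rabs_right, Rabs_left1 by lra. lra. }
assert (clamp_bound : forall z, -1 <= clamp z <= 1).
{ intros z. unfold clamp. unfold Rabs. destruct (Rcase_abs (z + 1)), (Rcase_abs (z - 1)); lra. }
assert (CH : forall w, -1 < w < 1 -> continuous H w).
{ intros w Hw. unfold H. unfold Rdiv.
  assert (0 < 1 - w ^ 2) by nra.
  apply (continuous_mult (K := R_AbsRing) (fun w => F (artanh w)) (fun w => / sqrt (1 - w ^ 2))).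
  - apply (continuous_comp artanh F); [|apply CF].
    exact (is_derive_continuous _ _ _ (is_derive_artanh w Hw)).
  - apply (ex_derive_continuous (fun w => / sqrt (1 - w ^ 2))). auto_derive.
    repeat split. lra. apply Rgt_not_eq, sqrt_lt_R0. lra. }
set (h := fun z => H (r * clamp z)).
assert (Ch : forall z, continuous h z).
{ intros z. unfold h. apply (continuous_comp (fun z => r * clamp z) H).
  - apply (continuous_scal_r (V := R_NormedModule)). unfold clamp.
    apply (continuous_scal_l (V := R_NormedModule) (fun z => Rabs (z + 1) - Rabs (z - 1)) (/ 2)).
    apply (continuous_minus (V := R_NormedModule) (fun z => Rabs (z + 1)) (fun z => Rabs (z - 1)));
    apply (continuous_comp _ Rabs); try apply continuous_Rabs.
    + apply (ex_derive_continuous (fun z => z + 1)). auto_derive. trivial.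
    + apply (ex_derive_continuous (fun z => z - 1)). auto_derive. trivial.
  - apply CH. specialize (clamp_bound z). split; nra. }
assert (A := archimedes_lower_bound h Ch L).
(* Substitution z = tanh t / r: [H] (tanh t) = F t cosh t and dz = dt / (r cosh^2 t). *)
assert (B : RInt h 0 1 = / r * RInt (fun u => F u / cosh u) 0 y).
{ assert (E := RInt_comp (V := R_CompleteNormedModule) h (fun t => tanh t / r) (fun t => / cosh t ^ 2 / r) 0 y).
  cbv beta in E.
  replace (tanh 0 / r) with 0 in E by (rewrite tanh_0; field; lra).
  replace (tanh y / r) with 1 in E by (fold r; field; lra).
  rewrite <- E; clear E.
  - rewrite <- (RInt_scal (V := R_CompleteNormedModule)).
    + apply RInt_eq. rewrite Rmin_left, Rmax_right by lra. intros t Ht.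
      assert (0 < tanh t) by (apply tanh_pos; lra).
      assert (tanh t <= r) by (apply tanh_le; lra).
      assert (0 <= tanh t / r <= 1).
      { split. apply Rdiv_le_0_compat; lra. apply Rle_div_l; lra. }
      unfold h. rewrite clamp_id by lra.
      replace (r * (tanh t / r)) with (tanh t) by (field; lra).
      unfold H. assert (S := inv_cosh_artanh (tanh t) (tanh_bound t)).
      rewrite artanh_tanh in *. rewrite <- S.
      unfold scal; simpl; unfold mult; simpl. assert (P := cosh_pos t). field. lra.
    + apply ex_RInt_cont. intros t.
      apply (continuous_mult (K := R_AbsRing) F (fun t => / cosh t)); [apply CF|apply continuous_inv_cosh].
  - intros; apply Ch.
  - intros t _. split.
    + apply (is_derive_scal_l tanh t (/ cosh t ^ 2) (/ r)), is_derive_tanh.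
    + apply (continuous_scal_l (V := R_NormedModule) (fun t => / cosh t ^ 2) (/ r)).
      apply continuous_inv_cosh_sq. }
rewrite B in A.
assert (A' : L <= PI / 2 * (/ r * RInt (fun u => F u / cosh u) 0 y)).
(* Heights are rescaled by r, so parameter p for [h] is the half circle of parameter r p. *)
{ apply A. intros p Hp. apply Rle_trans with (1 := HL (r * p) ltac:(split; nra)).
  right. apply RInt_eq. intros s _. unfold h. rewrite clamp_id.
  - unfold H. rewrite Rmult_assoc. reflexivity.
  - generalize (SIN_bound s). nra. }
assert (HPI := PI_RGT_0).
replace (RInt (fun u => F u / cosh u) 0 y)
  with (2 / PI * (PI / 2 * (/ r * RInt (fun u => F u / cosh u) 0 y)) * r).
- apply Rmult_le_compat_r; [lra|]. apply Rmult_le_compat_l; [|exact A'].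
  apply Rdiv_le_0_compat; lra.
- field. split; lra.
Qed.

(** The weight is G / cosh with G = 1 - c cosh, nonincreasing for y >= 0 and nonnegative up to [Y].
    Subtracting k / cosh^2, for which the annulus bound is an equality, leaves a density [d] whose
    integral over every [0, y] is nonnegative; integration by parts against [G] keeps this sign. *)
Lemma weighted_area_bound (F : R -> R) (L c Y : R) :
  (forall y, continuous F y) ->
  (forall p, 0 <= p < 1 ->
     L <= RInt (fun s => F (artanh (p * sin s)) / sqrt (1 - (p * sin s) ^ 2)) 0 (PI / 2)) ->
  0 <= Y -> 0 <= c -> c * cosh Y <= 1 ->
  2 / PI * L * (tanh Y - c * atan (sinh Y)) <= RInt (fun y => F y * (/ cosh y - c)) 0 Y.
Proof.
intros CF HL HY Hc HcY.
set (k := 2 / PI * L).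
set (d := fun y => F y / cosh y - k * / cosh y ^ 2).
assert (C1 : forall y, continuous (fun u => F u / cosh u) y).
{ intros y. apply (continuous_mult (K := R_AbsRing) F (fun t => / cosh t)); [apply CF|apply continuous_inv_cosh]. }
assert (C2 : forall y, continuous (fun u => k * / cosh u ^ 2) y).
{ intros y. apply (continuous_scal_r (V := R_NormedModule)), continuous_inv_cosh_sq. }
assert (Cd : forall y, continuous d y).
{ intros y. apply (continuous_minus (V := R_NormedModule) (fun u => F u / cosh u)); [apply C1|apply C2]. }
assert (Dpos : forall y, 0 <= y -> 0 <= RInt d 0 y).
{ intros y [Hy| <-]; [|right; symmetry; apply (RInt_point (V := R_CompleteNormedModule))].
  unfold d. rewrite (RInt_minus (V := R_CompleteNormedModule)) by (apply ex_RInt_cont; assumption).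
  rewrite (RInt_of_derive (fun y => k * tanh y) (fun u => k * / cosh u ^ 2)).
  - rewrite tanh_0. assert (A := area_bound_annulus F L CF HL y Hy).
    change (0 <= RInt (fun u => F u / cosh u) 0 y - (k * tanh y - k * 0)). unfold k. lra.
  - intros. apply is_derive_scal, is_derive_tanh.
  - intros; apply C2. }
set (G := fun y => 1 - c * cosh y).
assert (CG : forall y, continuous G y).
{ intros y. apply (ex_derive_continuous G). unfold G. auto_derive. trivial. }
assert (I := increment_le_RInt (fun y => RInt d 0 y * G y)
  (fun y => d y * G y - RInt d 0 y * (c * sinh y)) (fun y => d y * G y) 0 Y HY).
assert (I' : RInt d 0 Y * G Y - RInt d 0 0 * G 0 <= RInt (fun y => d y * G y) 0 Y).
{ apply I.
  - intros y _. assert (D := is_derive_RInt_cont d 0 y Cd). unfold G.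
    assert (DG : is_derive (fun y => 1 - c * cosh y) y (- (c * sinh y))).
    { auto_derive; [trivial|ring]. }
    replace (d y * (1 - c * cosh y) - RInt d 0 y * (c * sinh y))
      with (d y * (1 - c * cosh y) + RInt d 0 y * (- (c * sinh y))) by ring.
    apply (is_derive_mult (RInt d 0) (fun y => 1 - c * cosh y) y _ _ D DG). intros; apply Rmult_comm.
  - intros y. apply (continuous_mult (K := R_AbsRing) d G); [apply Cd|apply CG].
  - intros y Hy. assert (0 <= RInt d 0 y * (c * sinh y)); [|lra].
    apply Rmult_le_pos; [apply Dpos; lra|]. apply Rmult_le_pos; [exact Hc|apply sinh_nonneg; lra]. }
rewrite (RInt_point (V := R_CompleteNormedModule)) in I'. change (zero : R) with 0 in I'.
assert (0 <= RInt d 0 Y * G Y) by (apply Rmult_le_pos; [apply Dpos, HY|unfold G; lra]).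
assert (E : RInt (fun y => d y * G y) 0 Y =
  RInt (fun y => F y * (/ cosh y - c)) 0 Y - k * (tanh Y - c * atan (sinh Y))).
{ transitivity (RInt (fun y => minus (F y * (/ cosh y - c)) (k * (/ cosh y ^ 2 - c * / cosh y))) 0 Y).
  { apply RInt_eq. intros y _. unfold d, G, minus, plus, opp; simpl. field. generalize (cosh_pos y). lra. }
  rewrite (RInt_minus (V := R_CompleteNormedModule)).
  - rewrite (RInt_of_derive (fun y => k * (tanh y - c * atan (sinh y))) (fun y => k * (/ cosh y ^ 2 - c * / cosh y))).
    + rewrite tanh_0, sinh_0, atan_0. unfold minus, plus, opp; simpl. ring.
    + intros y _. apply is_derive_scal.
      apply (is_derive_minus (V := R_NormedModule) tanh (fun y => c * atan (sinh y))).
      apply is_derive_tanh. apply is_derive_scal, is_derive_atan_sinh.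
    + intros y _. apply (continuous_scal_r (V := R_NormedModule)).
      apply (continuous_minus (V := R_NormedModule) (fun y => / cosh y ^ 2)).
      apply continuous_inv_cosh_sq.
      apply (continuous_scal_r (V := R_NormedModule)), continuous_inv_cosh.
  - apply ex_RInt_cont. intros y. apply (continuous_mult (K := R_AbsRing) F); [apply CF|].
    apply (continuous_minus (V := R_NormedModule) (fun y => / cosh y)). apply continuous_inv_cosh.
    apply (continuous_const (V := R_UniformSpace)).
  - apply ex_RInt_cont. intros y. apply (continuous_scal_r (V := R_NormedModule)).
      apply (continuous_minus (V := R_NormedModule) (fun y => / cosh y ^ 2)).
      apply continuous_inv_cosh_sq.
      apply (continuous_scal_r (V := R_NormedModule)), continuous_inv_cosh. }
rewrite E in I'. lra.
Qed.

(** * The Klein bottle and lengths of curves *)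

Lemma is_derive_fst (e : R -> C) (s : R) (d : C) :
  @is_derive R_AbsRing C_R_NormedModule e s d -> is_derive (fun r => fst (e r)) s (fst d).
Proof.
intros H. apply (filterdiff_comp' (U := R_NormedModule) (V := C_R_NormedModule) (W := R_NormedModule)
  e (fun z : C => fst z) s (fun y => scal y d) (fun z : C => fst z) H).
apply (filterdiff_linear (U := prod_NormedModule R_AbsRing R_NormedModule R_NormedModule)).
apply is_linear_fst.
Qed.

Lemma is_derive_snd (e : R -> C) (s : R) (d : C) :
  @is_derive R_AbsRing C_R_NormedModule e s d -> is_derive (fun r => snd (e r)) s (snd d).
Proof.
intros H. apply (filterdiff_comp' (U := R_NormedModule) (V := C_R_NormedModule) (W := R_NormedModule)
  e (fun z : C => snd z) s (fun y => scal y d) (fun z : C => snd z) H).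
apply (filterdiff_linear (U := prod_NormedModule R_AbsRing R_NormedModule R_NormedModule)).
apply is_linear_snd.
Qed.

Lemma is_derive_pair (u v : R -> R) (s a b : R) :
  is_derive u s a -> is_derive v s b ->
  @is_derive R_AbsRing C_R_NormedModule (fun r => (u r, v r)) s (a, b).
Proof.
intros Hu Hv.
apply (filterdiff_comp'_2 (T := R_NormedModule) (U := R_NormedModule) (V := R_NormedModule)
  (W := C_R_NormedModule) u v (fun x y => (x, y)) s (fun y => scal y a) (fun y => scal y b)
  (fun x y => (x, y)) Hu Hv).
apply (filterdiff_ext (U := prod_NormedModule R_AbsRing R_NormedModule R_NormedModule) (fun z => z)).
- intros [x y]. reflexivity.
- apply (filterdiff_ext_lin (U := prod_NormedModule R_AbsRing R_NormedModule R_NormedModule) _ (fun z => z)).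
  + apply filterdiff_id.
  + intros [x y]. reflexivity.
Qed.

Lemma continuous_pair (u v : R -> R) (s : R) :
  continuous u s -> continuous v s -> continuous (fun r => (u r, v r)) s.
Proof.
intros Hu Hv P [d Hd].
specialize (Hu _ (locally_ball (u s) d)). specialize (Hv _ (locally_ball (v s) d)).
unfold filtermap in *. generalize (filter_and _ _ Hu Hv).
apply filter_imp. intros r [A B]. apply Hd. split; assumption.
Qed.

Section ConformalMetric.

Variable beta : R.

Lemma t_eq (x y : R) : t beta (x, y) = (x, y + beta).
Proof. unfold t, Ci, RtoC, Cplus, Cmult; simpl. f_equal; ring. Qed.

Lemma sigma_eq (x y : R) : Defs.sigma (x, y) = (x + PI, - y).
Proof. unfold Defs.sigma, Cconj, RtoC, Cplus; simpl. f_equal; ring. Qed.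

(** The maps of this form are closed under composition and inversion. They are more than [Gamma],
    since [a] is left free, but comparing the end points of a lifted curve involves only differences
    in x. *)
Lemma Gamma_form (h : C -> C) : Gamma beta h ->
  exists (e a : R) (k : Z), (e = 1 \/ e = -1) /\
    forall x y, h (x, y) = (x + a, e * y + IZR k * beta).
Proof.
induction 1 as [| |f h _ (e & a & k & He & Hf) _ (e' & a' & k' & He' & Hh)
               |f h _ (e & a & k & He & Hf) E1 E2].
- exists (-1), PI, 0%Z. split; [lra|]. intros. rewrite sigma_eq. f_equal. ring.
- exists 1, 0, 1%Z. split; [lra|]. intros. rewrite t_eq. f_equal; ring.
- destruct He as [-> | ->].
  + exists e', (a + a'), (k + k')%Z. split; [exact He'|]. intros.
    rewrite Hh, Hf, plus_IZR. f_equal; ring.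
  + exists (- e'), (a + a'), (k - k')%Z. split; [lra|]. intros.
    rewrite Hh, Hf, minus_IZR. f_equal; ring.
- destruct He as [-> | ->].
  + exists 1, (- a), (- k)%Z. split; [lra|]. intros x y.
    specialize (E1 (x, y)). destruct (h (x, y)) as [u v]. rewrite Hf in E1.
    injection E1; intros. rewrite opp_IZR. f_equal; lra.
  + exists (-1), (- a), k. split; [lra|]. intros x y.
    specialize (E1 (x, y)). destruct (h (x, y)) as [u v]. rewrite Hf in E1.
    injection E1; intros. f_equal; lra.
Qed.

Lemma Gamma_t_inv : Gamma beta (fun z => (fst z, snd z - beta)).
Proof.
apply Gamma_inv with (t beta); [apply Gamma_t| |]; intros [x y]; rewrite t_eq; simpl; f_equal; ring.
Qed.

Lemma Gamma_sigma_inv : Gamma beta (fun z => (fst z - PI, - snd z)).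
Proof.
apply Gamma_inv with Defs.sigma; [apply Gamma_sigma| |]; intros [x y]; rewrite sigma_eq; simpl; f_equal; ring.
Qed.

(** Horizontal translations are the powers of [sigma] composed with itself. The case of zero
    exponents supplies the identity, which [Gamma] contains only as a map composed with its
    inverse. *)
Lemma Gamma_translation (j k : Z) :
  exists h, Gamma beta h /\ forall x y, h (x, y) = (x + IZR j * (2 * PI), y + IZR k * beta).
Proof.
assert (Hx : exists h, Gamma beta h /\ forall x y, h (x, y) = (x + IZR j * (2 * PI), y)).
{ induction j as [|j (h & Hh & E)|j (h & Hh & E)] using Z.peano_ind.
  - exists (fun z => Defs.sigma ((fun z => (fst z - PI, - snd z)) z)). split.
    + apply (Gamma_comp beta Defs.sigma _ (Gamma_sigma beta) Gamma_sigma_inv).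
    + intros. rewrite sigma_eq; simpl; f_equal; ring.
  - exists (fun z => h ((fun z => Defs.sigma (Defs.sigma z)) z)). split.
    + apply (Gamma_comp beta h (fun z => Defs.sigma (Defs.sigma z)) Hh).
      apply (Gamma_comp beta Defs.sigma Defs.sigma); apply Gamma_sigma.
    + intros. rewrite !sigma_eq, E, succ_IZR. f_equal; ring.
  - exists (fun z => h ((fun z => (fun z => (fst z - PI, - snd z)) ((fun z => (fst z - PI, - snd z)) z)) z)). split.
    + apply (Gamma_comp beta h _ Hh).
      apply (Gamma_comp beta _ _ Gamma_sigma_inv Gamma_sigma_inv).
    + intros. simpl. rewrite E, <- Z.sub_1_r, minus_IZR. f_equal; ring. }
induction k as [|k (h & Hh & E)|k (h & Hh & E)] using Z.peano_ind.
- destruct Hx as (h & Hh & E). exists h. split; [exact Hh|]. intros. rewrite E. f_equal; ring.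
- exists (fun z => h (t beta z)). split; [apply (Gamma_comp beta h _ Hh), Gamma_t|].
  intros. rewrite t_eq, E, succ_IZR. f_equal; ring.
- exists (fun z => h ((fun z => (fst z, snd z - beta)) z)). split; [apply (Gamma_comp beta h _ Hh Gamma_t_inv)|].
  intros. simpl. rewrite E, <- Z.sub_1_r, minus_IZR. f_equal; ring.
Qed.

Variable g : conformal_metric beta.

Lemma metric_t (x y : R) : g (x, y + beta) = g (x, y).
Proof. rewrite <- t_eq. apply phi_inv, Gamma_t. Qed.

Lemma metric_sigma (x y : R) : g (x + PI, - y) = g (x, y).
Proof. rewrite <- sigma_eq. apply (phi_inv beta g Defs.sigma (Gamma_sigma beta)). Qed.

Lemma metric_cont2 (x y : R) : continuity_2d_pt (fun x y => g (x, y)) x y.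
Proof.
apply continuity_2d_pt_filterlim.
apply (filterlim_ext (fun z : R * R => g z)).
- intros [u v]. reflexivity.
- apply (phi_cont beta g (x, y)).
Qed.

(** Calibration: if [U] never grows faster than the length element, its increment bounds the length
    from below. The condition is stated along arbitrary differentiable curves, so that each explicit
    [U] brings its own chain rule and no differentiability in two variables is involved. *)
Lemma curve_length_piece (c : R -> C) (a b : R) (U : R -> R -> R) :
  a < b -> C1_on c a b ->
  (forall (u v : R -> R) (s du dv : R), is_derive u s du -> is_derive v s dv ->
     exists l, is_derive (fun r => U (u r) (v r)) s l /\
               l <= g (u s, v s) * sqrt (du ^ 2 + dv ^ 2)) ->
  ex_RInt (fun s => g (c s) * speed c s) a b /\
  U (fst (c b)) (snd (c b)) - U (fst (c a)) (snd (c a)) <=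
    RInt (fun s => g (c s) * speed c s) a b.
Proof.
intros Hab (e & d & He & Cd & Hce) HU.
set (G := fun s => g (e s) * Cmod (d s)).
(* Only inside the piece: at its ends [c] may have a corner, where [Derive] has no meaning. The
   integrand [G] of the extension is continuous everywhere. *)
assert (E : forall s, Rmin a b < s < Rmax a b -> G s = g (c s) * speed c s).
{ rewrite Rmin_left, Rmax_right by lra. intros s Hs. unfold G, speed.
  assert (Hl : locally s (fun r => e r = c r)).
  { generalize (filter_and _ _ (open_gt a s (proj1 Hs)) (open_lt b s (proj2 Hs))).
    apply filter_imp. intros r Hr. symmetry. apply Hce. lra. }
  rewrite (Hce s) by lra. f_equal.
  rewrite (Derive_eta (fun r => fst (c r)) s (fst (d s))), (Derive_eta (fun r => snd (c r)) s (snd (d s))).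
  - rewrite <- surjective_pairing. reflexivity.
  - apply (is_derive_ext_loc (fun r => snd (e r))); [|apply is_derive_snd, He].
    revert Hl. apply filter_imp. intros r ->. reflexivity.
  - apply (is_derive_ext_loc (fun r => fst (e r))); [|apply is_derive_fst, He].
    revert Hl. apply filter_imp. intros r ->. reflexivity. }
assert (CG : forall s, continuous G s).
{ intros s. unfold G.
  apply (continuous_mult (K := R_AbsRing) (fun s => g (e s)) (fun s => Cmod (d s))).
  - apply (continuous_comp (V := C_UniformSpace) e g); [|apply phi_cont].
    apply (ex_derive_continuous (V := C_R_NormedModule) e s). exists (d s). apply He.
  - unfold Cmod. apply continuous_sqrt_comp.
    assert (C1 : continuous (fun s => fst (d s)) s).
    { apply (continuous_comp (V := C_UniformSpace) d fst); [apply Cd|apply continuous_fst]. }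
    assert (C2 : continuous (fun s => snd (d s)) s).
    { apply (continuous_comp (V := C_UniformSpace) d snd); [apply Cd|apply continuous_snd]. }
    simpl. apply (continuous_plus (V := R_NormedModule));
    repeat apply (continuous_mult (K := R_AbsRing)); try assumption;
    apply (continuous_const (V := R_UniformSpace)). }
split.
- apply ex_RInt_ext with G; [exact E|]. apply ex_RInt_cont, CG.
- rewrite <- (RInt_eq G _ a b E). rewrite !Hce by lra.
  assert (D : forall s, exists l, is_derive (fun r => U (fst (e r)) (snd (e r))) s l /\ l <= G s).
  { intros s. destruct (HU (fun r => fst (e r)) (fun r => snd (e r)) s _ _
      (is_derive_fst _ _ _ (He s)) (is_derive_snd _ _ _ (He s))) as (l & Hl & Hle).
    exists l. split; [exact Hl|]. rewrite <- surjective_pairing in Hle. exact Hle. }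
  apply (increment_le_RInt (fun r => U (fst (e r)) (snd (e r)))
    (Derive (fun r => U (fst (e r)) (snd (e r)))) G a b); [lra| |exact CG|];
  intros s _; destruct (D s) as (l & Hl & Hle).
  + apply Derive_correct. now exists l.
  + rewrite (Derive_eta _ _ _ Hl). exact Hle.
Qed.

Lemma curve_length_ge (c : R -> C) (U : R -> R -> R) :
  piecewise_C1 c ->
  (forall (u v : R -> R) (s du dv : R), is_derive u s du -> is_derive v s dv ->
     exists l, is_derive (fun r => U (u r) (v r)) s l /\
               l <= g (u s, v s) * sqrt (du ^ 2 + dv ^ 2)) ->
  U (fst (c 1)) (snd (c 1)) - U (fst (c 0)) (snd (c 0)) <= curve_length beta g c.
Proof.
intros (n & u & Hu0 & Hun & Hp) HU.
set (f := fun s => g (c s) * speed c s).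
assert (W : forall m, (m <= n)%nat -> ex_RInt f 0 (u m) /\
  U (fst (c (u m))) (snd (c (u m))) - U (fst (c 0)) (snd (c 0)) <= RInt f 0 (u m)).
{ induction m as [|m IH]; intros Hm.
  - rewrite Hu0. split; [apply (ex_RInt_point (V := R_NormedModule))|].
    rewrite (RInt_point (V := R_CompleteNormedModule)). right. apply Rminus_diag.
  - destruct IH as [I1 I2]; [lia|]. destruct (Hp m) as [Hlt HC]; [lia|].
    destruct (curve_length_piece c (u m) (u (S m)) U Hlt HC HU) as [J1 J2]. fold f in J1, J2.
    split; [exact (ex_RInt_Chasles (V := R_NormedModule) f _ _ _ I1 J1)|].
    rewrite <- (RInt_Chasles (V := R_CompleteNormedModule) f _ _ _ I1 J1).
    unfold plus; simpl. lra. }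
destruct (W n) as [_ W2]; [lia|]. rewrite Hun in W2. exact W2.
Qed.

Lemma curve_length_nonneg (c : R -> C) : piecewise_C1 c -> 0 <= curve_length beta g c.
Proof.
intros Hc. replace 0 with (0 - 0) by ring.
apply (curve_length_ge c (fun _ _ => 0) Hc). intros u v s du dv _ _. exists 0. split.
- apply (is_derive_const (V := R_NormedModule)).
- apply Rmult_le_pos; [left; apply phi_pos|apply sqrt_pos].
Qed.

(** [real] turns an infinite bound into 0. Nonnegativity of lengths rules out minus infinity, and
    the given curve rules out plus infinity. *)
Lemma least_length_le (f : C -> C) (c : R -> C) :
  piecewise_C1 c -> lifts_free_class beta f c -> least_length beta g f <= curve_length beta g c.
Proof.
intros Hc Hl. unfold least_length.
match goal with |- real (Glb_Rbar ?E) <= _ => destruct (Glb_Rbar_correct E) as [H1 H2]; set (G := Glb_Rbar E) in * end.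
assert (H1' : Rbar_le G (curve_length beta g c)) by (apply H1; exists c; auto).
assert (H2' : Rbar_le 0 G).
{ apply H2. intros L (c' & Hc' & _ & ->). apply curve_length_nonneg, Hc'. }
destruct G; simpl in *; tauto.
Qed.

(** A curve in the class has to be exhibited: the infimum of the empty set is plus infinity, which
    [real] would read as 0. *)
Lemma least_length_ge (f : C -> C) (m : R) :
  (exists c, piecewise_C1 c /\ lifts_free_class beta f c) ->
  (forall c, piecewise_C1 c -> lifts_free_class beta f c -> m <= curve_length beta g c) ->
  m <= least_length beta g f.
Proof.
intros (c & Hc & Hl) Hm. unfold least_length.
match goal with |- _ <= real (Glb_Rbar ?E) => destruct (Glb_Rbar_correct E) as [H1 H2]; set (G := Glb_Rbar E) in * end.
assert (H1' : Rbar_le G (curve_length beta g c)) by (apply H1; exists c; auto).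
assert (H2' : Rbar_le m G).
{ apply H2. intros L (c' & Hc' & Hl' & ->). apply Hm; assumption. }
destruct G; simpl in *; tauto.
Qed.

Lemma piecewise_C1_smooth (u v du dv : R -> R) :
  (forall s, is_derive u s (du s)) -> (forall s, is_derive v s (dv s)) ->
  (forall s, continuous du s) -> (forall s, continuous dv s) ->
  piecewise_C1 (fun s => (u s, v s)).
Proof.
intros Hu Hv Cu Cv. exists 1%nat, INR. split; [reflexivity|split; [reflexivity|]]. intros i _. split.
- apply lt_INR. lia.
- exists (fun s => (u s, v s)), (fun s => (du s, dv s)). split; [|split].
  + intros s. apply is_derive_pair; auto.
  + intros s. apply continuous_pair; auto.
  + reflexivity.
Qed.

Lemma curve_length_smooth (u v du dv : R -> R) :
  (forall s, is_derive u s (du s)) -> (forall s, is_derive v s (dv s)) ->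
  curve_length beta g (fun s => (u s, v s)) =
  RInt (fun s => g (u s, v s) * sqrt (du s ^ 2 + dv s ^ 2)) 0 1.
Proof.
intros Hu Hv. apply RInt_eq. intros s _. unfold speed. simpl fst; simpl snd.
rewrite (Derive_eta u s _ (Hu s)), (Derive_eta v s _ (Hv s)). reflexivity.
Qed.

End ConformalMetric.

(** * Averages and upper bounds for the lengths *)

Lemma RInt_shift (f : R -> R) (a b v : R) :
  (forall x, continuous f x) ->
  RInt (fun x => f (x + v)) a b = RInt f (a + v) (b + v).
Proof.
intros Cf.
assert (E := RInt_comp_lin (V := R_CompleteNormedModule) f 1 v a b (ex_RInt_cont f _ _ Cf)).
rewrite !Rmult_1_l in E. rewrite <- E. apply RInt_eq. intros x _.
unfold scal; simpl; unfold mult; simpl. rewrite !Rmult_1_l. reflexivity.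
Qed.

Lemma RInt_reflect (f : R -> R) (a b v : R) :
  (forall x, continuous f x) ->
  RInt (fun x => f (v - x)) a b = RInt f (v - b) (v - a).
Proof.
intros Cf.
assert (E := RInt_comp_lin (V := R_CompleteNormedModule) f (-1) v a b (ex_RInt_cont f _ _ Cf)).
rewrite <- (opp_RInt_swap (V := R_CompleteNormedModule) f (v - a) (v - b)) by apply ex_RInt_cont, Cf.
replace (-1 * a + v) with (v - a) in E by ring.
replace (-1 * b + v) with (v - b) in E by ring.
rewrite <- E. rewrite <- (RInt_opp (V := R_CompleteNormedModule)).
- apply RInt_eq. intros x _. unfold scal, opp; simpl; unfold mult; simpl.
  replace (-1 * x + v) with (v - x) by ring. ring.
- apply ex_RInt_cont. intros x. apply (continuous_scal_r (V := R_NormedModule)).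
  apply (continuous_comp (fun y => -1 * y + v) f); [|apply Cf].
  apply (ex_derive_continuous (fun y => -1 * y + v)). auto_derive. trivial.
Qed.

Lemma RInt_split (f : R -> R) (a b c : R) :
  (forall x, continuous f x) -> RInt f a c = RInt f a b + RInt f b c.
Proof.
intros Cf. symmetry.
apply (RInt_Chasles (V := R_CompleteNormedModule)); apply ex_RInt_cont, Cf.
Qed.

Lemma RInt_periodic_shift (f : R -> R) (T a : R) :
  (forall x, continuous f x) -> (forall x, f (x + T) = f x) ->
  RInt f a (a + T) = RInt f 0 T.
Proof.
intros Cf Pf.
assert (E : RInt f T (a + T) = RInt f 0 a).
{ replace (RInt f T (a + T)) with (RInt f (0 + T) (a + T)) by (f_equal; ring).
  rewrite <- (RInt_shift f 0 a T Cf). apply RInt_eq. intros x _. apply Pf. }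
assert (E1 := RInt_split f 0 a (a + T) Cf). assert (E2 := RInt_split f 0 T (a + T) Cf). lra.
Qed.

Lemma RInt_even_periodic (f : R -> R) (T : R) :
  (forall x, continuous f x) -> (forall x, f (- x) = f x) -> (forall x, f (x + T) = f x) ->
  RInt f 0 T = 2 * RInt f 0 (T / 2).
Proof.
intros Cf Ef Pf.
assert (E : RInt f (T / 2) T = RInt f 0 (T / 2)).
{ assert (R1 := RInt_reflect f 0 (T / 2) T Cf).
  replace (T - T / 2) with (T / 2) in R1 by field. rewrite Rminus_0_r in R1. rewrite <- R1.
  apply RInt_eq. intros x _. replace (T - x) with (- x + T) by ring. rewrite Pf. apply Ef. }
rewrite (RInt_split f 0 (T / 2) T Cf), E. eqR. ring.
Qed.

Lemma RInt_even (f : R -> R) (a : R) :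
  (forall x, continuous f x) -> (forall x, f (- x) = f x) ->
  RInt f (- a) a = 2 * RInt f 0 a.
Proof.
intros Cf Ef.
assert (E : RInt f (- a) 0 = RInt f 0 a).
{ assert (R1 := RInt_reflect f 0 a 0 Cf). rewrite Rminus_0_r, Rminus_0_l in R1. rewrite <- R1.
  apply RInt_eq. intros x _. rewrite Rminus_0_l. apply Ef. }
rewrite (RInt_split f (- a) 0 a Cf), E. eqR. ring.
Qed.

Lemma RInt_const_mul (f : R -> R) (a b k : R) :
  (forall x, continuous f x) -> RInt (fun x => k * f x) a b = k * RInt f a b.
Proof.
intros Cf. apply (RInt_scal (V := R_CompleteNormedModule) f a b k). apply ex_RInt_cont, Cf.
Qed.

Lemma RInt_const_le (f : R -> R) (a b m : R) :
  a <= b -> (forall x, continuous f x) -> (forall x, m <= f x) -> (b - a) * m <= RInt f a b.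
Proof.
intros Hab Cf Hm.
replace ((b - a) * m) with (RInt (fun _ => m) a b).
- apply RInt_le; [exact Hab|apply ex_RInt_const|apply ex_RInt_cont, Cf|]. intros; apply Hm.
- apply (RInt_const (V := R_CompleteNormedModule)).
Qed.

Section Average.

Variable beta : R.
Variable psi : R -> R -> R.
Hypothesis psi_cont : forall x y, continuity_2d_pt psi x y.
Hypothesis psi_t : forall x y, psi x (y + beta) = psi x y.
Hypothesis psi_sigma : forall x y, psi (x + PI) (- y) = psi x y.

(** Not divided by 2 PI; this is the source of the factor PI in the bounds for [l_v] and [l_sigma]
    below. *)
Definition average (y : R) : R := RInt (fun x => psi x y) 0 (2 * PI).

Lemma continuous_invariant_x (y x : R) : continuous (fun x => psi x y) x.
Proof. apply continuity_2d_pt_section1, psi_cont. Qed.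

Lemma invariant_2PI (y x : R) : psi (x + 2 * PI) y = psi x y.
Proof. rewrite <- (psi_sigma x y), <- (psi_sigma (x + PI) (- y)). f_equal; ring. Qed.

Lemma continuous_average (y : R) : continuous average y.
Proof.
apply (continuous_RInt_param (fun y x => psi x y)). intros u v.
apply (continuity_2d_pt_comp psi (fun _ v => v) (fun u _ => u)).
apply psi_cont. apply continuity_2d_pt_id2. apply continuity_2d_pt_id1.
Qed.

Lemma average_shift (a y : R) : RInt (fun x => psi (x + a) y) 0 (2 * PI) = average y.
Proof.
rewrite (RInt_shift (fun x => psi x y)) by apply continuous_invariant_x.
replace (RInt (fun x => psi x y) (0 + a) (2 * PI + a))
  with (RInt (fun x => psi x y) a (a + 2 * PI)) by (f_equal; ring).
apply RInt_periodic_shift; [apply continuous_invariant_x|apply invariant_2PI].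
Qed.

(** The reflection of y alone is not a deck transformation; the horizontal shift by PI that comes
    with it in [sigma] is absorbed by the average. *)
Lemma average_opp (y : R) : average (- y) = average y.
Proof.
rewrite <- (average_shift PI y). apply RInt_eq. intros x _.
rewrite <- (psi_sigma x (- y)), Ropp_involutive. reflexivity.
Qed.

Lemma average_t (y : R) : average (y + beta) = average y.
Proof. apply RInt_eq. intros x _. apply psi_t. Qed.

Lemma RInt_average : RInt average 0 beta = 2 * RInt average 0 (beta / 2).
Proof. apply RInt_even_periodic; [apply continuous_average|apply average_opp|apply average_t]. Qed.

(** By [sigma], doubling the domain to [0, 2 PI] x [0, beta] doubles the integral; by evenness, so
    does passing from [0, beta / 2] to [0, beta] for the average. The two factors cancel. *)
Lemma RInt_fundamental_domain :
  RInt (fun x => RInt (fun y => psi x y) 0 beta) 0 PI = RInt average 0 (beta / 2).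
Proof.
set (V := fun x => RInt (fun y => psi x y) 0 beta).
assert (CV : forall x, continuous V x) by (apply continuous_RInt_param, psi_cont).
assert (HV : forall x, V (x + PI) = V x).
{ intros x. unfold V.
  assert (R1 := RInt_reflect (psi x) 0 beta beta (fun y => continuity_2d_pt_section2 _ _ _ (psi_cont x y))).
  rewrite Rminus_0_r, Rminus_diag in R1. etransitivity; [|exact R1].
  apply RInt_eq. intros y _. replace (beta - y) with (- y + beta) by ring.
  rewrite psi_t, <- (psi_sigma x (- y)), Ropp_involutive. reflexivity. }
assert (E : RInt V 0 (2 * PI) = RInt average 0 beta) by (apply RInt_fubini, psi_cont).
rewrite RInt_average in E.
assert (E1 := RInt_split V 0 PI (2 * PI) CV).
assert (E2 : RInt V PI (2 * PI) = RInt V 0 PI).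
{ replace (RInt V PI (2 * PI)) with (RInt V (0 + PI) (PI + PI)) by (f_equal; ring).
  rewrite <- (RInt_shift V 0 PI PI CV). apply RInt_eq. intros x _. apply HV. }
lra.
Qed.

End Average.

(* Longitude along a half great circle of maximal latitude arccos q: a smooth
   determination of arctan (q tan tau). *)
Definition longitude (q tau : R) : R :=
  tau - atan ((1 - q) * sin tau * cos tau / (cos tau ^ 2 + q * sin tau ^ 2)).

Lemma is_derive_longitude (q tau : R) : 0 < q ->
  is_derive (longitude q) tau (q / (1 - (1 - q ^ 2) * sin tau ^ 2)).
Proof.
intros Hq. unfold longitude.
assert (Hc : cos tau ^ 2 = 1 - sin tau ^ 2) by (generalize (sin2_cos2 tau); unfold Rsqr; lra).
assert (HD : 0 < cos tau ^ 2 + q * sin tau ^ 2).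
{ assert (0 <= sin tau ^ 2) by apply pow2_ge_0. assert (0 <= cos tau ^ 2) by apply pow2_ge_0.
  destruct (Rle_dec (sin tau ^ 2) 0); nra. }
assert (HE : 0 < 1 - (1 - q ^ 2) * sin tau ^ 2).
{ assert (0 <= sin tau ^ 2) by apply pow2_ge_0. assert (0 <= cos tau ^ 2) by apply pow2_ge_0.
  assert (0 < q ^ 2) by (apply pow_lt, Hq).
  destruct (Rle_dec (sin tau ^ 2) 0); nra. }
auto_derive; [lra|].
set (s := sin tau) in *. set (k := cos tau) in *.
(* The denominator and the numerator of the arctangent are the real and imaginary parts of (k + i
   s)(k - i q s), of square modulus k^2 + q^2 s^2. *)
assert (Q : (k * (k * 1) + q * (s * (s * 1))) ^ 2 + ((1 - q) * s * k) ^ 2 = 1 - (1 - q ^ 2) * s ^ 2).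
{ transitivity ((k ^ 2) ^ 2 + q ^ 2 * (s ^ 2) ^ 2 + (1 + q ^ 2) * s ^ 2 * k ^ 2); [ring|]. rewrite Hc. ring. }
set (D := k * (k * 1) + q * (s * (s * 1))) in *.
assert (HD' : 0 < D) by (unfold D; lra).
set (N := (1 - q) * s * k) in *.
replace (1 + N * / D * (N * / D * 1)) with ((D ^ 2 + N ^ 2) / D ^ 2) by (field; lra).
rewrite Q.
match goal with |- 1 + - (?A * / _) = _ =>
  replace A with ((1 - q) * (k ^ 2 - q * s ^ 2) / D ^ 2) end.
- field_simplify_eq; [|split; lra]. rewrite Hc. ring.
- assert (E : (1 - q) * (k ^ 2 - q * s ^ 2) = (1 - q) * (k ^ 2 - s ^ 2) * D + 2 * (1 - q) * s * k * N).
  { unfold D, N. transitivity ((1 - q) * ((k ^ 2) ^ 2 - q * (s ^ 2) ^ 2 + (1 - q) * s ^ 2 * k ^ 2)); [|ring].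
    rewrite Hc. ring. }
  rewrite E. field. lra.
Qed.

Lemma is_derive_comp_affine (f : R -> R) (x k m s l : R) :
  is_derive f (k * s + m) l -> is_derive (fun s => x + f (k * s + m)) s (k * l).
Proof.
intros D. auto_derive; [exact (ex_intro _ _ D)|]. rewrite (Derive_eta _ _ _ D). ring.
Qed.

Section UpperBounds.

Variable beta : R.
Hypothesis hbeta : 0 < beta.
Variable g : conformal_metric beta.

Let gf x y := g (x, y).
Let F := average gf.

Let Cgf x y : continuity_2d_pt gf x y := metric_cont2 beta g x y.
Let CF y : continuous F y := continuous_average gf Cgf y.
Let Fopp y : F (- y) = F y := average_opp gf Cgf (metric_sigma beta g) y.

Lemma vertical_curve (x : R) :
  let c := fun s => (x, beta * s) in
  piecewise_C1 c /\ lifts_free_class beta (t beta) c /\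
  curve_length beta g c = RInt (fun y => g (x, y)) 0 beta.
Proof.
intros c.
assert (D1 : forall s, is_derive (fun _ : R => x) s 0).
{ intros s. apply (is_derive_const (V := R_NormedModule)). }
assert (D2 : forall s, is_derive (fun s : R => beta * s) s beta).
{ intros s. auto_derive; [trivial|ring]. }
split; [|split].
- apply (piecewise_C1_smooth (fun _ => x) (fun s => beta * s) (fun _ => 0) (fun _ => beta) D1 D2);
  intros; apply (continuous_const (V := R_UniformSpace)).
- destruct (Gamma_translation beta 0 0) as (h & Hh & E). exists h, (x, 0). split; [exact Hh|].
  rewrite t_eq, !E. unfold c. split; f_equal; ring.
- unfold c. rewrite (curve_length_smooth beta g _ _ _ _ D1 D2).
  assert (E := RInt_comp_lin (V := R_CompleteNormedModule) (gf x) beta 0 0 1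
     (ex_RInt_cont _ _ _ (fun y => continuity_2d_pt_section2 _ _ _ (Cgf x y)))).
  replace (beta * 0 + 0) with 0 in E by ring. replace (beta * 1 + 0) with beta in E by ring.
  etransitivity; [|exact E]. apply RInt_eq. intros s _.
  unfold scal, gf; simpl; unfold mult; simpl.
  replace (0 * (0 * 1) + beta * (beta * 1)) with (beta ^ 2) by ring.
  rewrite sqrt_pow2, Rplus_0_r by lra. ring.
Qed.

Lemma l_v_le_average : PI * l_v beta g <= RInt F 0 (beta / 2).
Proof.
assert (HPI := PI_RGT_0).
assert (H : forall x, l_v beta g <= RInt (gf x) 0 beta).
{ intros x. destruct (vertical_curve x) as (H1 & H2 & H3). unfold l_v.
  apply Rle_trans with (1 := least_length_le beta g _ _ H1 H2). right. exact H3. }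
assert (I := RInt_const_le _ 0 (2 * PI) (l_v beta g) ltac:(lra) (continuous_RInt_param gf 0 beta Cgf) H).
assert (E : RInt (fun x => RInt (gf x) 0 beta) 0 (2 * PI) = RInt F 0 beta) by (apply RInt_fubini, Cgf).
assert (I' : (2 * PI - 0) * l_v beta g <= RInt F 0 beta) by (rewrite <- E; exact I).
clear I; rename I' into I. unfold F in I. rewrite (RInt_average beta gf Cgf) in I.
- fold F in I. lra.
- exact (metric_t beta g).
- exact (metric_sigma beta g).
Qed.

Let half_circle_lat (p tau : R) := artanh (p * sin tau).

Let sin_small (p tau : R) : 0 <= p < 1 -> -1 < p * sin tau < 1.
Proof. intros Hp. generalize (SIN_bound tau). intros. split; nra. Qed.

Let D_lat (p tau : R) : 0 <= p < 1 ->
  is_derive (half_circle_lat p) tau (p * cos tau / (1 - p ^ 2 * sin tau ^ 2)).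
Proof.
intros Hp. assert (Hs := sin_small p tau Hp).
assert (D := is_derive_artanh _ Hs). unfold half_circle_lat.
assert ((p * sin tau) ^ 2 < 1) by nra.
assert (Hd : 1 - p ^ 2 * sin tau ^ 2 <> 0) by (replace (p ^ 2 * sin tau ^ 2) with ((p * sin tau) ^ 2) by ring; lra).
apply (is_derive_ext (fun tau => artanh (p * sin tau))); [reflexivity|].
replace (p * cos tau / (1 - p ^ 2 * sin tau ^ 2))
  with (scal (p * cos tau) (/ (1 - (p * sin tau) ^ 2))).
- apply (is_derive_comp artanh (fun tau => p * sin tau)); [exact D|]. auto_derive; [trivial|ring].
- change (p * cos tau * / (1 - (p * sin tau) ^ 2) = p * cos tau / (1 - p ^ 2 * sin tau ^ 2)).
  replace ((p * sin tau) ^ 2) with (p ^ 2 * sin tau ^ 2) by ring. reflexivity.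
Qed.

(** Here tau is arc length on a great circle of the sphere, with sine of latitude tanh y = p sin
    tau. Its Euclidean speed in the Mercator chart is therefore cosh y = 1 / sqrt (1 - (p sin
    tau)^2). Over [-PI / 2, PI / 2] the longitude grows by PI and the height changes sign, as
    [sigma] prescribes. *)
Lemma half_circle_curve (p x : R) : 0 <= p < 1 ->
  let q := sqrt (1 - p ^ 2) in
  let c := fun s => (x + longitude q (PI * s - PI / 2), artanh (p * sin (PI * s - PI / 2))) in
  piecewise_C1 c /\ lifts_free_class beta Defs.sigma c /\
  curve_length beta g c =
    RInt (fun tau => g (x + longitude q tau, artanh (p * sin tau)) / sqrt (1 - (p * sin tau) ^ 2))
      (- (PI / 2)) (PI / 2).
Proof.
intros Hp q c. assert (HPI := PI_RGT_0).
assert (Hp2 : 0 < 1 - p ^ 2) by nra.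
assert (Hq : 0 < q) by (apply sqrt_lt_R0, Hp2).
assert (Hq2 : q ^ 2 = 1 - p ^ 2) by (unfold q; rewrite pow2_sqrt; lra).
assert (Hpos : forall tau, 0 < 1 - p ^ 2 * sin tau ^ 2).
{ intros tau. assert (Hs := sin_small p tau Hp). nra. }
set (du := fun tau => q / (1 - p ^ 2 * sin tau ^ 2)).
set (dv := fun tau => p * cos tau / (1 - p ^ 2 * sin tau ^ 2)).
assert (Du : forall tau, is_derive (longitude q) tau (du tau)).
{ intros tau. generalize (is_derive_longitude q tau Hq).
  replace (1 - q ^ 2) with (p ^ 2) by lra. exact (fun H => H). }
assert (D1 : forall s, is_derive (fun s => x + longitude q (PI * s - PI / 2)) s (PI * du (PI * s - PI / 2))).
{ intros s. apply is_derive_comp_affine, Du. }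
assert (D2 : forall s, is_derive (fun s => half_circle_lat p (PI * s - PI / 2)) s (PI * dv (PI * s - PI / 2))).
{ intros s. generalize (is_derive_comp_affine (half_circle_lat p) 0 PI (- (PI / 2)) s _ (D_lat p _ Hp)).
  apply is_derive_ext. intros u. apply Rplus_0_l. }
assert (Cdu : forall s, continuous (fun s => PI * du (PI * s - PI / 2)) s).
{ intros s. apply (continuous_scal_r (V := R_NormedModule) PI).
  apply (continuous_comp (fun s => PI * s - PI / 2) du).
  - apply (ex_derive_continuous (fun s => PI * s - PI / 2)). auto_derive. trivial.
  - apply (ex_derive_continuous du). unfold du.
    generalize (Hpos (PI * s - PI / 2)). intros. auto_derive. simpl in *. lra. }
assert (Cdv : forall s, continuous (fun s => PI * dv (PI * s - PI / 2)) s).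
{ intros s. apply (continuous_scal_r (V := R_NormedModule) PI).
  apply (continuous_comp (fun s => PI * s - PI / 2) dv).
  - apply (ex_derive_continuous (fun s => PI * s - PI / 2)). auto_derive. trivial.
  - apply (ex_derive_continuous dv). unfold dv.
    generalize (Hpos (PI * s - PI / 2)). intros. auto_derive. simpl in *. lra. }
assert (Lm : longitude q (- (PI / 2)) = - (PI / 2)).
{ unfold longitude. rewrite cos_neg, cos_PI2, Rmult_0_r, Rdiv_0_l, atan_0. ring. }
assert (Lp : longitude q (PI / 2) = PI / 2).
{ unfold longitude. rewrite cos_PI2, Rmult_0_r, Rdiv_0_l, atan_0. ring. }
split; [|split].
- exact (piecewise_C1_smooth _ _ _ _ D1 D2 Cdu Cdv).
- destruct (Gamma_translation beta 0 0) as (h & Hh & E). exists h, (c 0). split; [exact Hh|].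
  unfold c. rewrite sigma_eq, !E.
  replace (PI * 0 - PI / 2) with (- (PI / 2)) by ring.
  replace (PI * 1 - PI / 2) with (PI / 2) by field.
  rewrite Lm, Lp, sin_neg, sin_PI2.
  split; f_equal; try field.
  rewrite <- Ropp_mult_distr_r, (artanh_opp (p * 1)) by lra. ring.
- unfold c. rewrite (curve_length_smooth beta g (fun s => x + longitude q (PI * s - PI / 2))
    (fun s => artanh (p * sin (PI * s - PI / 2))) _ _ D1 D2).
  set (f := fun tau => g (x + longitude q tau, artanh (p * sin tau)) / sqrt (1 - (p * sin tau) ^ 2)).
  assert (E := RInt_comp_lin (V := R_CompleteNormedModule) f PI (- (PI / 2)) 0 1).
  replace (PI * 0 + - (PI / 2)) with (- (PI / 2)) in E by ring.
  replace (PI * 1 + - (PI / 2)) with (PI / 2) in E by field.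
  etransitivity; [|apply E].
  + apply RInt_eq. intros s _. unfold scal; simpl; unfold mult; simpl.
    replace (PI * s + - (PI / 2)) with (PI * s - PI / 2) by ring.
    set (tau := PI * s - PI / 2). specialize (Hpos tau).
    assert (Hc : cos tau ^ 2 = 1 - sin tau ^ 2) by (generalize (sin2_cos2 tau); unfold Rsqr; lra).
    replace (PI * du tau * (PI * du tau * 1) + PI * dv tau * (PI * dv tau * 1))
      with (PI ^ 2 * / (1 - (p * sin tau) ^ 2)).
    * rewrite sqrt_mult_alt, sqrt_pow2, sqrt_inv by (try apply pow2_ge_0; lra).
      unfold f. unfold half_circle_lat, Rdiv. ring.
    * unfold du, dv.
      transitivity (PI ^ 2 * (q ^ 2 + p ^ 2 * cos tau ^ 2) / (1 - p ^ 2 * sin tau ^ 2) ^ 2).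
      -- rewrite Hq2, Hc. replace ((p * sin tau) ^ 2) with (p ^ 2 * sin tau ^ 2) by ring. field. lra.
      -- field. lra.
  + apply ex_RInt_cont. intros tau. unfold f, Rdiv.
    apply (continuous_mult (K := R_AbsRing) (fun tau => g (x + longitude q tau, artanh (p * sin tau)))
      (fun tau => / sqrt (1 - (p * sin tau) ^ 2))).
    * apply (continuous_comp (V := C_UniformSpace) (fun tau => (x + longitude q tau, artanh (p * sin tau))) g);
        [|apply phi_cont].
      apply continuous_pair.
      -- apply (continuous_plus (V := R_NormedModule) (fun _ => x) (longitude q)).
         apply (continuous_const (V := R_UniformSpace)).
         exact (is_derive_continuous _ _ _ (Du tau)).
      -- exact (is_derive_continuous _ _ _ (D_lat p tau Hp)).
    * apply (ex_derive_continuous (fun tau => / sqrt (1 - (p * sin tau) ^ 2))).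
      assert (Hs := sin_small p tau Hp). assert (0 < 1 - (p * sin tau) ^ 2) by nra.
      auto_derive. split; [lra|split; [|trivial]]. apply Rgt_not_eq, sqrt_lt_R0. lra.
Qed.

(** The half circle is rotated through all [x]. After exchanging the integrals, the longitude is a
    mere translation inside a full period and drops out; evenness in tau then leaves the quarter
    circle. *)
Lemma l_sigma_le_average (p : R) : 0 <= p < 1 ->
  PI * l_sigma beta g <=
  RInt (fun s => F (artanh (p * sin s)) / sqrt (1 - (p * sin s) ^ 2)) 0 (PI / 2).
Proof.
intros Hp. assert (HPI := PI_RGT_0).
set (q := sqrt (1 - p ^ 2)).
assert (Hq : 0 < q) by (apply sqrt_lt_R0; nra).
set (w := fun tau => / sqrt (1 - (p * sin tau) ^ 2)).
set (G := fun x tau => gf (x + longitude q tau) (artanh (p * sin tau)) * w tau).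
assert (Cw : forall tau, continuous w tau).
{ intros tau. apply (ex_derive_continuous (fun tau => / sqrt (1 - (p * sin tau) ^ 2))).
  assert (Hs := sin_small p tau Hp). assert (0 < 1 - (p * sin tau) ^ 2) by nra.
  auto_derive. split; [lra|split; [|trivial]]. apply Rgt_not_eq, sqrt_lt_R0. lra. }
assert (Clat : forall tau, continuous (fun tau => artanh (p * sin tau)) tau).
{ intros tau. exact (is_derive_continuous _ _ _ (D_lat p tau Hp)). }
assert (CG : forall x tau, continuity_2d_pt G x tau).
{ intros x tau. apply continuity_2d_pt_mult; [|apply (continuity_2d_pt_of2 w), Cw].
  apply (continuity_2d_pt_comp gf (fun x tau => x + longitude q tau) (fun _ tau => artanh (p * sin tau))).
  - apply Cgf.
  - apply continuity_2d_pt_plus; [apply continuity_2d_pt_id1|].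
    apply (continuity_2d_pt_of2 (longitude q)).
    exact (is_derive_continuous _ _ _ (is_derive_longitude q tau Hq)).
  - apply (continuity_2d_pt_of2 (fun tau => artanh (p * sin tau))), Clat. }
assert (H : forall x, l_sigma beta g <= RInt (G x) (- (PI / 2)) (PI / 2)).
{ intros x. destruct (half_circle_curve p x Hp) as (H1 & H2 & H3). unfold l_sigma.
  apply Rle_trans with (1 := least_length_le beta g _ _ H1 H2). right. exact H3. }
assert (I := RInt_const_le _ 0 (2 * PI) (l_sigma beta g) ltac:(lra)
  (continuous_RInt_param G _ _ CG) H).
assert (E : RInt (fun x => RInt (G x) (- (PI / 2)) (PI / 2)) 0 (2 * PI) =
  RInt (fun tau => F (artanh (p * sin tau)) * w tau) (- (PI / 2)) (PI / 2)).
{ etransitivity; [apply (RInt_fubini G), CG|]. apply RInt_eq. intros tau _.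
  unfold G, F. rewrite <- (average_shift gf Cgf (metric_sigma beta g) (longitude q tau)).
  rewrite (Rmult_comm _ (w tau)). rewrite <- RInt_const_mul.
  - apply RInt_eq. intros; ring.
  - intros x. apply (continuous_comp (fun x => x + longitude q tau) (fun x => gf x (artanh (p * sin tau)))).
    + apply (ex_derive_continuous (fun x => x + longitude q tau)). auto_derive. trivial.
    + apply continuous_invariant_x, Cgf. }
assert (I' : (2 * PI - 0) * l_sigma beta g <=
  RInt (fun tau => F (artanh (p * sin tau)) * w tau) (- (PI / 2)) (PI / 2)) by (rewrite <- E; exact I).
clear I; rename I' into I. rewrite (RInt_even (fun tau => F (artanh (p * sin tau)) * w tau)) in I.
- unfold w in I. unfold Rdiv. lra.
- intros tau. apply (continuous_mult (K := R_AbsRing) (fun tau => F (artanh (p * sin tau))) w); [|apply Cw].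
  apply (continuous_comp (fun tau => artanh (p * sin tau)) F); [apply Clat|apply CF].
- intros tau. unfold w. rewrite sin_neg. replace (p * - sin tau) with (- (p * sin tau)) by ring.
  rewrite artanh_opp by apply sin_small, Hp. rewrite Fopp.
  replace ((- (p * sin tau)) ^ 2) with ((p * sin tau) ^ 2) by ring. reflexivity.
Qed.

Lemma l_v_nonneg : 0 <= l_v beta g.
Proof.
destruct (vertical_curve 0) as (H1 & H2 & _).
apply least_length_ge; [eexists; split; [exact H1|exact H2]|].
intros. apply curve_length_nonneg. assumption.
Qed.

Lemma l_sigma_nonneg : 0 <= l_sigma beta g.
Proof.
destruct (half_circle_curve 0 0 ltac:(lra)) as (H1 & H2 & _).
apply least_length_ge; [eexists; split; [exact H1|exact H2]|].
intros. apply curve_length_nonneg. assumption.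
Qed.

Let S := average (fun x y => gf x y ^ 2).

Let Cgf2 x y : continuity_2d_pt (fun x y => gf x y ^ 2) x y.
Proof.
apply (continuity_1d_2d_pt_comp (fun r => r ^ 2) gf); [|apply Cgf].
apply continuity_pt_filterlim. apply (ex_derive_continuous (fun r => r ^ 2)). auto_derive. trivial.
Qed.

Lemma vol_eq_average : vol beta g = RInt S 0 (beta / 2).
Proof.
apply (RInt_fundamental_domain beta (fun x y => gf x y ^ 2) Cgf2); intros x y; unfold gf.
- rewrite metric_t. reflexivity.
- rewrite metric_sigma. reflexivity.
Qed.

(** The integral of (phi - k)^2 >= 0: Cauchy-Schwarz in linear form, with [k] free to depend on
    y. *)
Lemma average_sq_ge (k y : R) : 2 * k * F y - 2 * PI * k ^ 2 <= S y.
Proof.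
assert (HPI := PI_RGT_0).
assert (C1 : forall x, continuous (fun x => gf x y) x) by (apply continuous_invariant_x, Cgf).
assert (E : RInt (fun x => 2 * k * gf x y - k ^ 2) 0 (2 * PI) = 2 * k * F y - 2 * PI * k ^ 2).
{ rewrite (RInt_minus (V := R_CompleteNormedModule) (fun x => 2 * k * gf x y) (fun _ => k ^ 2)).
  - rewrite RInt_const_mul by apply C1. rewrite RInt_const.
    unfold minus, plus, opp, scal; simpl; unfold mult; simpl. unfold F, average. ring.
  - apply ex_RInt_cont. intros x. apply (continuous_scal_r (V := R_NormedModule) (2 * k)), C1.
  - apply ex_RInt_const. }
rewrite <- E. apply RInt_le; [lra| | |].
- apply ex_RInt_cont. intros x.
  apply (continuous_minus (V := R_NormedModule) (fun x => 2 * k * gf x y) (fun _ => k ^ 2)).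
  apply (continuous_scal_r (V := R_NormedModule) (2 * k)), C1. apply (continuous_const (V := R_UniformSpace)).
- apply ex_RInt_cont. intros x. apply (continuous_invariant_x _ Cgf2).
- intros x _. generalize (pow2_ge_0 (gf x y - k)). nra.
Qed.

(* Cauchy-Schwarz against the extremal metric, which is 1 / cosh y up to [Y]
   and 1 / cosh Y beyond; [c] is the weight of the vertical curves. *)
Lemma conformal_isosystolic_bound (Y c : R) :
  0 < Y <= beta / 2 -> 0 < c -> c * cosh Y <= 1 ->
  (Y = beta / 2 \/ c * cosh Y = 1) ->
  tanh Y + (beta / 2 - Y) * / cosh Y ^ 2 = 2 * (tanh Y - c * atan (sinh Y)) ->
  2 * c * (l_v beta g * l_sigma beta g) <= vol beta g.
Proof.
intros HY Hc HcY Halt Hv. assert (HPI := PI_RGT_0). assert (HC := cosh_pos Y).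
(* The extremal metric has area 2 PI [v0]. *)
set (v0 := tanh Y + (beta / 2 - Y) * / cosh Y ^ 2) in *.
assert (Hv0 : 0 < v0).
{ assert (0 < tanh Y) by (apply tanh_pos; lra).
  assert (0 <= (beta / 2 - Y) * / cosh Y ^ 2); [|unfold v0; lra].
  apply Rmult_le_pos; [lra|]. left. apply Rinv_0_lt_compat, pow_lt, HC. }
assert (Ci : forall y, continuous (fun y => F y * / cosh y) y).
{ intros y. apply (continuous_mult (K := R_AbsRing) F); [apply CF|apply continuous_inv_cosh]. }
assert (CS : forall y, continuous S y) by (apply continuous_average, Cgf2).
set (lv := l_v beta g). set (ls := l_sigma beta g).
set (M1 := RInt (fun y => F y * / cosh y) 0 Y). set (M2 := RInt F Y (beta / 2)).
(* The right side pairs [F] with the extremal density over half a period. Half circles bound the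
   part 1 / cosh - c, contributing ls v0 thanks to the balance [Hv]; vertical curves bound the
   constant part c, which fills [Y, beta / 2] entirely. *)
assert (HM : ls * v0 + c * PI * lv <= M1 + / cosh Y * M2).
{ assert (W := weighted_area_bound F (PI * ls) c Y CF (fun p Hp => l_sigma_le_average p Hp)
     ltac:(lra) ltac:(lra) HcY).
  assert (E : RInt (fun y => F y * (/ cosh y - c)) 0 Y = M1 - c * RInt F 0 Y).
  { rewrite <- (RInt_const_mul F 0 Y c CF). unfold M1.
    rewrite <- (RInt_minus (V := R_CompleteNormedModule)).
    - apply RInt_eq. intros y _. unfold minus, plus, opp; simpl. ring.
    - apply ex_RInt_cont, Ci.
    - apply ex_RInt_cont. intros y. apply (continuous_scal_r (V := R_NormedModule) c), CF. }
  rewrite E in W. clear E.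
  assert (HV := l_v_le_average). fold lv in HV. rewrite (RInt_split F 0 Y (beta / 2) CF) in HV. fold M2 in HV.
  replace (2 / PI * (PI * ls) * (tanh Y - c * atan (sinh Y))) with (ls * v0) in W
    by (rewrite Hv; field; lra).
  assert (E : c * M2 = / cosh Y * M2).
  { destruct Halt as [-> | Hcc].
    - unfold M2. rewrite RInt_point. change (c * 0 = / cosh (beta / 2) * 0). ring.
    - replace (/ cosh Y) with c; [reflexivity|]. apply Rmult_eq_reg_r with (cosh Y); [|lra].
      rewrite Hcc. field. lra. }
  rewrite <- E. assert (c * (PI * lv) <= c * (RInt F 0 Y + M2)) by (apply Rmult_le_compat_l; lra).
  lra. }
set (m := ls * v0 + c * PI * lv) in *.
assert (Hm : 0 <= m).
{ assert (0 <= lv) by apply l_v_nonneg. assert (0 <= ls) by apply l_sigma_nonneg.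
  unfold m. apply Rplus_le_le_0_compat; repeat first [lra | apply Rmult_le_pos]. }
(* The maximizer of 2 k m - 2 PI k^2 v0: the multiple of the extremal metric closest to the given
   one, as far as the lower bound [m] can tell. *)
set (k := m / (2 * PI * v0)).
assert (Hk : 0 <= k) by (apply Rdiv_le_0_compat; [exact Hm|]; repeat first [lra | apply Rmult_lt_0_compat]).
assert (V1 : 2 * k * M1 - 2 * PI * k ^ 2 * tanh Y <= RInt S 0 Y).
{ assert (E : RInt (fun y => 2 * k * (F y * / cosh y) - 2 * PI * k ^ 2 * / cosh y ^ 2) 0 Y =
     2 * k * M1 - 2 * PI * k ^ 2 * tanh Y).
  { rewrite (RInt_minus (V := R_CompleteNormedModule)
      (fun y => 2 * k * (F y * / cosh y)) (fun y => 2 * PI * k ^ 2 * / cosh y ^ 2)).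
    - rewrite RInt_const_mul by apply Ci. rewrite RInt_const_mul by apply continuous_inv_cosh_sq.
      rewrite (RInt_of_derive tanh (fun y => / cosh y ^ 2)).
      + rewrite tanh_0. unfold minus, plus, opp; simpl. fold M1. ring.
      + intros; apply is_derive_tanh.
      + intros; apply continuous_inv_cosh_sq.
    - apply ex_RInt_cont. intros y. apply (continuous_scal_r (V := R_NormedModule) (2 * k)), Ci.
    - apply ex_RInt_cont. intros y.
      apply (continuous_scal_r (V := R_NormedModule) (2 * PI * k ^ 2)), continuous_inv_cosh_sq. }
  rewrite <- E. apply RInt_le; [lra| |apply ex_RInt_cont, CS|].
  - apply ex_RInt_cont. intros y.
    apply (continuous_minus (V := R_NormedModule)
      (fun y => 2 * k * (F y * / cosh y)) (fun y => 2 * PI * k ^ 2 * / cosh y ^ 2)).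
    apply (continuous_scal_r (V := R_NormedModule) (2 * k)), Ci.
    apply (continuous_scal_r (V := R_NormedModule) (2 * PI * k ^ 2)), continuous_inv_cosh_sq.
  - intros y _. generalize (average_sq_ge (k * / cosh y) y). intros A.
    rewrite Rpow_mult_distr, pow_inv in A. lra. }
assert (V2 : 2 * k * (/ cosh Y * M2) - 2 * PI * k ^ 2 * ((beta / 2 - Y) * / cosh Y ^ 2) <= RInt S Y (beta / 2)).
{ set (k' := k * / cosh Y).
  assert (E : RInt (fun y => 2 * k' * F y - 2 * PI * k' ^ 2) Y (beta / 2) =
     2 * k * (/ cosh Y * M2) - 2 * PI * k ^ 2 * ((beta / 2 - Y) * / cosh Y ^ 2)).
  { rewrite (RInt_minus (V := R_CompleteNormedModule)
      (fun y => 2 * k' * F y) (fun y => 2 * PI * k' ^ 2)).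
    - rewrite RInt_const_mul by apply CF. rewrite RInt_const.
      unfold minus, plus, opp, scal; simpl; unfold mult; simpl. fold M2. unfold k'. field. lra.
    - apply ex_RInt_cont. intros y. apply (continuous_scal_r (V := R_NormedModule) (2 * k')), CF.
    - apply ex_RInt_const. }
  rewrite <- E. apply RInt_le; [lra| |apply ex_RInt_cont, CS|].
  - apply ex_RInt_cont. intros y.
    apply (continuous_minus (V := R_NormedModule) (fun y => 2 * k' * F y) (fun y => 2 * PI * k' ^ 2)).
    apply (continuous_scal_r (V := R_NormedModule) (2 * k')), CF.
    apply (continuous_const (V := R_UniformSpace)).
  - intros y _. apply average_sq_ge. }
rewrite vol_eq_average, (RInt_split S 0 Y (beta / 2) CS).
apply Rle_trans with (2 * k * (M1 + / cosh Y * M2) - 2 * PI * k ^ 2 * v0);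
  [|unfold v0; lra].
apply Rle_trans with (2 * k * m - 2 * PI * k ^ 2 * v0);
  [|assert (2 * k * m <= 2 * k * (M1 + / cosh Y * M2)) by (apply Rmult_le_compat_l; lra); lra].
replace (2 * k * m - 2 * PI * k ^ 2 * v0) with (m ^ 2 / (2 * PI * v0)) by (unfold k; field; lra).
apply (Rle_div_r _ _ (2 * PI * v0)); [repeat first [lra | apply Rmult_lt_0_compat]|].
(* Arithmetic and geometric means; the square vanishes when both families contribute equally to
   [m]. *)
replace (m ^ 2) with ((ls * v0 - c * PI * lv) ^ 2 + 2 * c * (lv * ls) * (2 * PI * v0)) by (unfold m; ring).
generalize (pow2_ge_0 (ls * v0 - c * PI * lv)). lra.
Qed.

End UpperBounds.

(* Reified functions, closed under partial derivatives: this gives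
   differentiability at every order by induction on the order. *)
Inductive expr : Type :=
| Const (r : R) | VarX | VarY | CosX | SinX | SechY | TanhY
| Add (e1 e2 : expr) | Mul (e1 e2 : expr).

(** The parameter [m] is the height of the equator at which the Mercator chart is centred, so that
    one list of constructors serves all vertical translates. *)
Fixpoint eval (m : R) (e : expr) (x y : R) : R :=
  match e with
  | Const r => r
  | VarX => x
  | VarY => y
  | CosX => cos x
  | SinX => sin x
  | SechY => / cosh (y - m)
  | TanhY => tanh (y - m)
  | Add e1 e2 => eval m e1 x y + eval m e2 x y
  | Mul e1 e2 => eval m e1 x y * eval m e2 x y
  end.

Fixpoint expr_dx (e : expr) : expr :=
  match e with
  | VarX => Const 1
  | CosX => Mul (Const (-1)) SinX
  | SinX => CosX
  | Add e1 e2 => Add (expr_dx e1) (expr_dx e2)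
  | Mul e1 e2 => Add (Mul (expr_dx e1) e2) (Mul e1 (expr_dx e2))
  | _ => Const 0
  end.

Fixpoint expr_dy (e : expr) : expr :=
  match e with
  | VarY => Const 1
  | SechY => Mul (Const (-1)) (Mul SechY TanhY)
  | TanhY => Mul SechY SechY
  | Add e1 e2 => Add (expr_dy e1) (expr_dy e2)
  | Mul e1 e2 => Add (Mul (expr_dy e1) e2) (Mul e1 (expr_dy e2))
  | _ => Const 0
  end.

Section Eval.

Variable m : R.

Lemma is_derive_eval_x (e : expr) (x y : R) :
  is_derive (fun u => eval m e u y) x (eval m (expr_dx e) x y).
Proof.
induction e as [| | | | | | |e1 IH1 e2 IH2|e1 IH1 e2 IH2]; simpl;
  try apply (is_derive_const (V := R_NormedModule)).
- apply (is_derive_id (K := R_AbsRing)).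
- auto_derive; [trivial|ring].
- auto_derive; [trivial|ring].
- apply (is_derive_plus (V := R_NormedModule) (fun u => eval m e1 u y) (fun u => eval m e2 u y)); assumption.
- apply (is_derive_mult (fun u => eval m e1 u y) (fun u => eval m e2 u y)); try assumption. apply Rmult_comm.
Qed.

Lemma is_derive_eval_y (e : expr) (x y : R) :
  is_derive (fun v => eval m e x v) y (eval m (expr_dy e) x y).
Proof.
assert (HC := cosh_pos (y - m)).
induction e as [| | | | | | |e1 IH1 e2 IH2|e1 IH1 e2 IH2]; simpl;
  try apply (is_derive_const (V := R_NormedModule)).
- apply (is_derive_id (K := R_AbsRing)).
- auto_derive; change (y + - m) with (y - m); [lra|]. unfold tanh. field. lra.
- replace (/ cosh (y - m) * / cosh (y - m)) with (1 * / cosh (y - m) ^ 2) by (field; lra).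
  apply (is_derive_comp tanh (fun y => y - m)); [apply is_derive_tanh|].
  auto_derive; [trivial|ring].
- apply (is_derive_plus (V := R_NormedModule) (fun u => eval m e1 x u) (fun u => eval m e2 x u)); assumption.
- apply (is_derive_mult (fun u => eval m e1 x u) (fun u => eval m e2 x u)); try assumption. apply Rmult_comm.
Qed.

Lemma continuity_2d_pt_eval (e : expr) (x y : R) : continuity_2d_pt (eval m e) x y.
Proof.
induction e as [r| | | | | | |e1 IH1 e2 IH2|e1 IH1 e2 IH2]; simpl.
- apply continuity_2d_pt_const.
- apply continuity_2d_pt_id1.
- apply continuity_2d_pt_id2.
- apply (continuity_2d_pt_of1 cos), continuous_cos.
- apply (continuity_2d_pt_of1 sin), continuous_sin.
- apply (continuity_2d_pt_of2 (fun v => / cosh (v - m))).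
  exact (is_derive_continuous _ _ _ (is_derive_eval_y SechY x y)).
- apply (continuity_2d_pt_of2 (fun v => tanh (v - m))).
  exact (is_derive_continuous _ _ _ (is_derive_eval_y TanhY x y)).
- apply continuity_2d_pt_plus; assumption.
- apply continuity_2d_pt_mult; assumption.
Qed.

Lemma ex_diff_n_eval (n : nat) (e : expr) (x y : R) : ex_diff_n (eval m e) n x y.
Proof.
revert e. induction n as [|n IH]; intros e; (split; [apply continuity_2d_pt_eval|]); [trivial|].
split; [eexists; apply is_derive_eval_x|].
split; [eexists; apply is_derive_eval_y|].
replace (fun u v => Derive (fun z => eval m e z v) u) with (eval m (expr_dx e)).
replace (fun u v => Derive (fun z => eval m e u z) v) with (eval m (expr_dy e)).
- split; apply IH.
- apply functional_extensionality; intros u; apply functional_extensionality; intros v.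
  symmetry. apply is_derive_unique, is_derive_eval_y.
- apply functional_extensionality; intros u; apply functional_extensionality; intros v.
  symmetry. apply is_derive_unique, is_derive_eval_x.
Qed.

Lemma smooth_at_eval (e : expr) (w : C) : smooth_at (fun z => eval m e (fst z) (snd z)) w.
Proof. intros n. apply ex_diff_n_eval. Qed.

Lemma dx_eval (e : expr) (w : C) :
  dx (fun z => eval m e (fst z) (snd z)) w = eval m (expr_dx e) (fst w) (snd w).
Proof. apply is_derive_unique. simpl. apply is_derive_eval_x. Qed.

Lemma dy_eval (e : expr) (w : C) :
  dy (fun z => eval m e (fst z) (snd z)) w = eval m (expr_dy e) (fst w) (snd w).
Proof. apply is_derive_unique. simpl. apply is_derive_eval_y. Qed.

End Eval.

(** * The extremal metric *)

Section ExtremalMetric.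

Variable beta : R.
Hypothesis hbeta : 0 < beta.

(** The lattice is beta Z; [Int_part] of y / beta + 1 / 2 rounds to a nearest integer. *)
Definition dist_lattice (y : R) : R := Rabs (y - IZR (Int_part (y / beta + / 2)) * beta).

Lemma dist_lattice_attained (y : R) : exists k : Z, dist_lattice y = Rabs (y - IZR k * beta).
Proof. eexists. reflexivity. Qed.

Lemma dist_lattice_le (y : R) (j : Z) : dist_lattice y <= Rabs (y - IZR j * beta).
Proof.
unfold dist_lattice. set (k := Int_part (y / beta + / 2)).
destruct (base_Int_part (y / beta + / 2)) as [H1 H2]. fold k in H1, H2.
assert (E : y = y / beta * beta) by (field; lra).
set (r := y / beta) in *. rewrite E, <- !Rmult_minus_distr_r, !Rabs_mult.
apply Rmult_le_compat_r; [apply Rabs_pos|].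
destruct (Z.lt_trichotomy j k) as [H | [-> | H]]; [|lra|].
- apply Zlt_le_succ, IZR_le in H. rewrite succ_IZR in H.
  rewrite (Rabs_right (r - IZR j)) by lra. apply Rabs_le. lra.
- apply Zlt_le_succ, IZR_le in H. rewrite succ_IZR in H.
  rewrite (Rabs_left (r - IZR j)) by lra. apply Rabs_le. lra.
Qed.

(** A minimum of 1-Lipschitz functions is 1-Lipschitz. Continuity is obtained this way because
    [Int_part] jumps halfway between lattice points. *)
Lemma dist_lattice_lipschitz (y y' : R) : dist_lattice y <= dist_lattice y' + Rabs (y - y').
Proof.
destruct (dist_lattice_attained y') as [k ->].
apply Rle_trans with (1 := dist_lattice_le y k).
rewrite Rplus_comm. replace (y - IZR k * beta) with ((y - y') + (y' - IZR k * beta)) by ring.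
apply Rabs_triang.
Qed.

Lemma dist_lattice_opp (y : R) : dist_lattice (- y) = dist_lattice y.
Proof.
assert (W : forall y, dist_lattice (- y) <= dist_lattice y).
{ clear y. intros y. destruct (dist_lattice_attained y) as [k ->].
  apply Rle_trans with (1 := dist_lattice_le (- y) (- k)). rewrite opp_IZR.
  replace (- y - - IZR k * beta) with (- (y - IZR k * beta)) by ring. rewrite Rabs_Ropp. lra. }
apply Rle_antisym; [apply W|]. generalize (W (- y)). rewrite Ropp_involutive. trivial.
Qed.

Lemma dist_lattice_translate (y : R) (j : Z) : dist_lattice (y + IZR j * beta) = dist_lattice y.
Proof.
assert (W : forall y j, dist_lattice (y + IZR j * beta) <= dist_lattice y).
{ clear y j. intros y j. destruct (dist_lattice_attained y) as [k ->].
  apply Rle_trans with (1 := dist_lattice_le _ (k + j)). rewrite plus_IZR.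
  right. f_equal. ring. }
apply Rle_antisym; [apply W|]. generalize (W (y + IZR j * beta) (- j)%Z). rewrite opp_IZR.
replace (y + IZR j * beta + - IZR j * beta) with y by ring. trivial.
Qed.

Lemma dist_lattice_small (y : R) : Rabs y <= beta / 2 -> dist_lattice y = Rabs y.
Proof.
intros Hy. apply Rle_antisym.
- generalize (dist_lattice_le y 0). rewrite Rmult_0_l, Rminus_0_r. trivial.
- destruct (dist_lattice_attained y) as [k ->].
  destruct (Z.eq_dec k 0) as [-> | Hk]; [rewrite Rmult_0_l, Rminus_0_r; lra|].
  assert (H : beta <= Rabs (IZR k * beta)).
  { rewrite Rabs_mult, (Rabs_right beta) by lra.
    assert (1 <= Rabs (IZR k)); [|nra]. rewrite <- abs_IZR. apply IZR_le. lia. }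
  generalize (Rabs_triang_inv (IZR k * beta) y). rewrite Rabs_minus_sym. lra.
Qed.

Lemma dist_lattice_max (y : R) : dist_lattice y <= beta / 2.
Proof.
unfold dist_lattice. set (k := Int_part (y / beta + / 2)).
destruct (base_Int_part (y / beta + / 2)) as [H1 H2]. fold k in H1, H2.
assert (E : y = y / beta * beta) by (field; lra).
set (r := y / beta) in *. rewrite E, <- !Rmult_minus_distr_r, !Rabs_mult, (Rabs_right beta) by lra.
assert (Rabs (r - IZR k) <= / 2) by (apply Rabs_le; lra). nra.
Qed.

Lemma continuous_dist_lattice (y : R) : continuous dist_lattice y.
Proof.
apply filterlim_locally. intros eps. exists eps. intros y' Hy.
change (Rabs (y' - y) < eps) in Hy. change (Rabs (dist_lattice y' - dist_lattice y) < eps).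
apply Rle_lt_trans with (2 := Hy). apply Rabs_le.
generalize (dist_lattice_lipschitz y' y) (dist_lattice_lipschitz y y').
rewrite (Rabs_minus_sym y y'). lra.
Qed.

Variable Y : R.
Hypothesis hY : 0 < Y <= beta / 2.

Definition profile (y : R) : R := / cosh (Rmin (dist_lattice y) Y).

Lemma dist_lattice_nonneg (y : R) : 0 <= dist_lattice y.
Proof. apply Rabs_pos. Qed.

Lemma profile_pos (y : R) : 0 < profile y.
Proof. apply Rinv_0_lt_compat, cosh_pos. Qed.

Lemma continuous_profile (y : R) : continuous profile y.
Proof.
unfold profile. apply (continuous_comp (fun y => Rmin (dist_lattice y) Y) (fun r => / cosh r));
  [|apply continuous_inv_cosh].
apply (continuous_ext (fun y => (dist_lattice y + Y - Rabs (dist_lattice y - Y)) * / 2)).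
{ intros r. unfold Rmin, Rabs. destruct (Rle_dec (dist_lattice r) Y), (Rcase_abs (dist_lattice r - Y)); lra. }
assert (CY : continuous (fun _ : R => Y) y) by apply (continuous_const (V := R_UniformSpace)).
apply (continuous_scal_l (V := R_NormedModule) (fun y => dist_lattice y + Y - Rabs (dist_lattice y - Y)) (/ 2)).
apply (continuous_minus (V := R_NormedModule) (fun y => dist_lattice y + Y) (fun y => Rabs (dist_lattice y - Y))).
- apply (continuous_plus (V := R_NormedModule) dist_lattice (fun _ => Y)); [apply continuous_dist_lattice|exact CY].
- apply continuous_Rabs_comp.
  apply (continuous_minus (V := R_NormedModule) dist_lattice (fun _ => Y)); [apply continuous_dist_lattice|exact CY].
Qed.

Lemma profile_opp (y : R) : profile (- y) = profile y.
Proof. unfold profile. rewrite dist_lattice_opp. reflexivity. Qed.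

Lemma profile_translate (y : R) (k : Z) : profile (y + IZR k * beta) = profile y.
Proof. unfold profile. rewrite dist_lattice_translate. reflexivity. Qed.

Lemma profile_t (y : R) : profile (y + beta) = profile y.
Proof. rewrite <- (profile_translate y 1), Rmult_1_l. reflexivity. Qed.

Lemma profile_Gamma (f : C -> C) (Hf : Gamma beta f) (z : C) : profile (snd (f z)) = profile (snd z).
Proof.
destruct (Gamma_form beta f Hf) as (e & a & k & He & E). destruct z as [x y]. rewrite E. simpl.
rewrite profile_translate. destruct He as [-> | ->].
- rewrite Rmult_1_l. reflexivity.
- replace (-1 * y) with (- y) by ring. apply profile_opp.
Qed.

Lemma profile_cont (z : C) : continuous (fun z : C => profile (snd z)) z.
Proof.
apply (continuous_comp (U := C_UniformSpace) (fun z : C => snd z) profile); [|apply continuous_profile].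
apply continuous_snd.
Qed.

Definition extremal_metric : conformal_metric beta :=
  ConformalMetric beta (fun z => profile (snd z)) (fun z => profile_pos (snd z)) profile_cont profile_Gamma.

Lemma cosh_le (a b : R) : 0 <= a <= b -> cosh a <= cosh b.
Proof.
intros H. destruct (MVT_gen cosh a b sinh) as [c [Hc E]].
- intros x _. auto_derive; [trivial|ring].
- intros x _. apply continuity_pt_filterlim. apply (ex_derive_continuous cosh). auto_derive. trivial.
- rewrite Rmin_left in Hc by lra. assert (0 <= sinh c) by (apply sinh_nonneg; lra). nra.
Qed.

Lemma cosh_Rabs (y : R) : cosh (Rabs y) = cosh y.
Proof. unfold Rabs. destruct (Rcase_abs y); [apply cosh_opp|reflexivity]. Qed.

(** For every [k], not only for the nearest lattice line: a curve that strays far can still be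
    compared with one fixed sphere along its whole length. *)
Lemma profile_ge (y : R) (k : Z) : / cosh (y - IZR k * beta) <= profile y.
Proof.
apply Rinv_le_contravar; [apply cosh_pos|]. rewrite <- (cosh_Rabs (y - IZR k * beta)).
apply cosh_le. split.
- apply Rmin_glb; [apply dist_lattice_nonneg|lra].
- apply Rle_trans with (1 := Rmin_l _ _). apply dist_lattice_le.
Qed.

Lemma profile_near (y : R) (k : Z) :
  Rabs (y - IZR k * beta) <= Y -> profile y = / cosh (y - IZR k * beta).
Proof.
intros H. unfold profile.
replace (dist_lattice y) with (Rabs (y - IZR k * beta)).
- rewrite Rmin_left, cosh_Rabs by exact H. reflexivity.
- rewrite <- dist_lattice_small by lra.
  replace (y - IZR k * beta) with (y + IZR (- k) * beta) by (rewrite opp_IZR; ring).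
  apply dist_lattice_translate.
Qed.

Lemma profile_far (y : R) : Y <= dist_lattice y -> profile y = / cosh Y.
Proof. intros H. unfold profile. rewrite Rmin_right by exact H. reflexivity. Qed.

Lemma profile_low (y : R) : 0 <= y <= Y -> profile y = / cosh y.
Proof.
intros H. rewrite (profile_near y 0); [|rewrite Rabs_right; lra].
rewrite Rmult_0_l, Rminus_0_r. reflexivity.
Qed.

Lemma profile_high (y : R) : Y <= y <= beta / 2 -> profile y = / cosh Y.
Proof. intros H. apply profile_far. rewrite dist_lattice_small; rewrite Rabs_right; lra. Qed.

Lemma RInt_profile : RInt profile 0 beta = 2 * (atan (sinh Y) + (beta / 2 - Y) * / cosh Y).
Proof.
rewrite (RInt_even_periodic profile beta continuous_profile profile_opp profile_t).
rewrite (RInt_split profile 0 Y (beta / 2) continuous_profile). f_equal. f_equal.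
- rewrite (RInt_eq profile (fun y => / cosh y)).
  + rewrite (RInt_of_derive (fun y => atan (sinh y)) (fun y => / cosh y)).
    * rewrite sinh_0, atan_0. apply Rminus_0_r.
    * intros; apply is_derive_atan_sinh.
    * intros; apply continuous_inv_cosh.
  + rewrite Rmin_left, Rmax_right by lra. intros y Hy. apply profile_low. lra.
- rewrite (RInt_eq profile (fun _ => / cosh Y)).
  + apply (RInt_const (V := R_CompleteNormedModule)).
  + rewrite Rmin_left, Rmax_right by lra. intros y Hy. apply profile_high. lra.
Qed.

Lemma vol_extremal_metric :
  vol beta extremal_metric = 2 * PI * (tanh Y + (beta / 2 - Y) * / cosh Y ^ 2).
Proof.
assert (C2 : forall y, continuous (fun y => profile y ^ 2) y).
{ intros y. apply (continuous_comp profile (fun r => r ^ 2)); [apply continuous_profile|].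
  apply (ex_derive_continuous (fun r => r ^ 2)). auto_derive. trivial. }
assert (E : RInt (fun y => profile y ^ 2) 0 beta = 2 * (tanh Y + (beta / 2 - Y) * / cosh Y ^ 2)).
{ rewrite (RInt_even_periodic (fun y => profile y ^ 2) beta C2).
  - rewrite (RInt_split (fun y : R => profile y ^ 2) 0 Y (beta / 2) C2). f_equal. f_equal.
    + rewrite (RInt_eq (fun y : R => profile y ^ 2) (fun y => / cosh y ^ 2)).
      * rewrite (RInt_of_derive tanh (fun y => / cosh y ^ 2)).
        -- rewrite tanh_0. apply Rminus_0_r.
        -- intros; apply is_derive_tanh.
        -- intros; apply continuous_inv_cosh_sq.
      * rewrite Rmin_left, Rmax_right by lra. intros y Hy.
        rewrite profile_low by lra. apply pow_inv.
    + rewrite (RInt_eq (fun y : R => profile y ^ 2) (fun _ => / cosh Y ^ 2)).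
      * apply (RInt_const (V := R_CompleteNormedModule)).
      * rewrite Rmin_left, Rmax_right by lra. intros y Hy.
        rewrite profile_high by lra. apply pow_inv.
  - intros y. rewrite profile_opp. reflexivity.
  - intros y. rewrite profile_t. reflexivity. }
unfold vol. simpl phi. cbv beta. simpl snd. rewrite E, RInt_const.
change ((PI - 0) * (2 * (tanh Y + (beta / 2 - Y) * / cosh Y ^ 2)) = 2 * PI * (tanh Y + (beta / 2 - Y) * / cosh Y ^ 2)).
ring.
Qed.

(** * Lower bounds for the lengths in the extremal metric *)

Lemma dot_product_le_norm (a b du dv : R) :
  a * du + b * dv <= sqrt (a ^ 2 + b ^ 2) * sqrt (du ^ 2 + dv ^ 2).
Proof.
rewrite <- sqrt_mult_alt by nra.
apply Rle_trans with (1 := Rle_abs _). rewrite <- sqrt_Rsqr_abs. apply sqrt_le_1_alt.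
unfold Rsqr. generalize (pow2_ge_0 (a * dv - b * du)). lra.
Qed.

(** Calibrated by the primitive of the profile, which grows by the same amount over every vertical
    period. The sign [e] treats the conjugates in which the translation runs downwards. *)
Lemma l_v_extremal_metric : RInt profile 0 beta <= l_v beta extremal_metric.
Proof.
destruct (vertical_curve beta hbeta extremal_metric 0) as (H1 & H2 & _).
apply least_length_ge; [eexists; split; [exact H1|exact H2]|].
intros c Hc (h & z & Hh & E0 & E1).
destruct (Gamma_form beta h Hh) as (e & a & k & He & E). destruct z as [x y].
rewrite t_eq in E1. rewrite E in E0, E1.
set (P := fun y : R => RInt profile 0 y : R).
assert (Q : forall y, P (y + beta) = P y + P beta).
{ intros y'. unfold P. rewrite (RInt_split profile 0 y' (y' + beta) continuous_profile).
  rewrite (RInt_periodic_shift profile beta y' continuous_profile profile_t). reflexivity. }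
assert (B : P beta = e * P (snd (c 1)) - e * P (snd (c 0))).
{ rewrite E0, E1. simpl. destruct He as [-> | ->].
  - replace (1 * (y + beta) + IZR k * beta) with (1 * y + IZR k * beta + beta) by ring.
    rewrite Q. ring.
  - replace (-1 * y + IZR k * beta) with (-1 * (y + beta) + IZR k * beta + beta) by ring.
    rewrite Q. ring. }
change (P beta <= curve_length beta extremal_metric c). rewrite B.
apply (curve_length_ge beta extremal_metric c (fun _ v => e * P v) Hc).
intros u v s du dv Hu Hv. exists (e * (dv * profile (v s))). split.
- apply is_derive_scal.
  apply (is_derive_comp (RInt profile 0) v); [|exact Hv].
  apply is_derive_RInt_cont, continuous_profile.
- simpl phi. cbv beta. simpl snd. assert (Hp := profile_pos (v s)).
  replace (e * (dv * profile (v s))) with (profile (v s) * (e * dv)) by ring.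
  apply Rmult_le_compat_l; [lra|].
  apply Rle_trans with (1 := Rle_abs _). rewrite <- sqrt_Rsqr_abs. apply sqrt_le_1_alt.
  unfold Rsqr. destruct He as [-> | ->]; nra.
Qed.
Lemma is_derive_asin (w : R) : -1 < w < 1 -> is_derive asin w (/ sqrt (1 - w ^ 2)).
Proof.
intros Hw. apply is_derive_Reals.
replace (/ sqrt (1 - w ^ 2)) with (derive_pt asin w (derivable_pt_asin w Hw)).
- apply (derive_pt_eq_1 _ _ _ (derivable_pt_asin w Hw)). reflexivity.
- rewrite derive_pt_asin. unfold Rsqr. rewrite Rdiv_1_l. f_equal. f_equal. ring.
Qed.

(* cos of the spherical distance between the points of coordinates (0, b) and
   (x, y) of the Mercator chart. *)
Definition cos_dist (b x y : R) : R := cos x * / cosh b * / cosh y + tanh b * tanh y.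

Definition cos_dist_x (b x y : R) : R := - sin x * / cosh b * / cosh y.

Definition cos_dist_y (b x y : R) : R :=
  - cos x * / cosh b * (tanh y * / cosh y) + tanh b * / cosh y ^ 2.

(** A distance function d has unit gradient, so |grad cos d|^2 = 1 - cos^2 d on the sphere; the
    factor 1 / cosh^2 passes to the Euclidean gradient of the conformal chart. *)
Lemma cos_dist_gradient (b x y : R) :
  cos_dist_x b x y ^ 2 + cos_dist_y b x y ^ 2 = (1 - cos_dist b x y ^ 2) * / cosh y ^ 2.
Proof.
unfold cos_dist, cos_dist_x, cos_dist_y.
assert (Hb := cosh_pos b). assert (Hy := cosh_pos y).
assert (Tb := tanh_sq b). assert (Ty := tanh_sq y).
rewrite <- pow_inv in Tb, Ty.
replace (/ cosh y ^ 2) with ((/ cosh y) ^ 2) by apply pow_inv.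
assert (Sx : sin x ^ 2 = 1 - cos x ^ 2) by (generalize (sin2_cos2 x); unfold Rsqr; lra).
set (A := / cosh b) in *. set (S := / cosh y) in *. set (B := tanh b) in *. set (T := tanh y) in *.
transitivity (S ^ 2 * (sin x ^ 2 * A ^ 2 + cos x ^ 2 * A ^ 2 * T ^ 2 + B ^ 2 * S ^ 2
  - 2 * cos x * A * T * B * S)); [ring|].
transitivity (S ^ 2 * (1 - cos x ^ 2 * A ^ 2 * S ^ 2 - B ^ 2 * T ^ 2 - 2 * cos x * A * T * B * S)); [|ring].
rewrite Sx, Tb, Ty. ring.
Qed.

(** Read off from the gradient identity, whose left side is a sum of squares. *)
Lemma cos_dist_bound (b x y : R) : cos_dist b x y ^ 2 <= 1.
Proof.
assert (G := cos_dist_gradient b x y).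
assert (0 < / cosh y ^ 2) by (apply Rinv_0_lt_compat, pow_lt, cosh_pos).
assert (0 <= (1 - cos_dist b x y ^ 2) * / cosh y ^ 2).
{ rewrite <- G. apply Rplus_le_le_0_compat; apply pow2_ge_0. }
destruct (Rle_dec (cos_dist b x y ^ 2) 1) as [Hle|Hn]; [exact Hle|nra].
Qed.

Lemma is_derive_cos_dist (b : R) (u v : R -> R) (s du dv : R) :
  is_derive u s du -> is_derive v s dv ->
  is_derive (fun r => cos_dist b (u r) (v r)) s
    (cos_dist_x b (u s) (v s) * du + cos_dist_y b (u s) (v s) * dv).
Proof.
intros Hu Hv. unfold cos_dist, cos_dist_x, cos_dist_y, tanh.
assert (Hy := cosh_pos (v s)). assert (E := cosh_sq (v s)).
auto_derive.
- repeat split; try exact (ex_intro _ _ Hu); try exact (ex_intro _ _ Hv); lra.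
- rewrite (Derive_eta _ _ _ Hu), (Derive_eta _ _ _ Hv).
  replace (/ cosh (v s) ^ 2) with ((cosh (v s) ^ 2 - sinh (v s) ^ 2) / cosh (v s) ^ 2)
    by (replace (cosh (v s) ^ 2 - sinh (v s) ^ 2) with 1 by lra; apply Rdiv_1_l).
  field. split; apply Rgt_not_eq, cosh_pos.
Qed.

(* The extremal metric dominates the pullback of the round sphere by the
   Mercator chart, where the end points of the curve are antipodal. *)
Lemma l_sigma_extremal_metric : PI <= l_sigma beta extremal_metric.
Proof.
destruct (half_circle_curve beta extremal_metric 0 0 ltac:(lra)) as (H1 & H2 & _).
apply least_length_ge; [eexists; split; [exact H1|exact H2]|].
intros c Hc (h & z & Hh & E0 & E1).
destruct (Gamma_form beta h Hh) as (e & a & k & He & E). destruct z as [x y].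
rewrite sigma_eq in E1. rewrite E in E0, E1.
(* Relative to the line of height [m], the curve runs from (x0, b) to (x0 + PI, -b), which are
   antipodal on the sphere centred at that line. *)
set (m := IZR k * beta) in *. set (x0 := x + a). set (b := e * y).
(* The distance itself is not differentiable at the end points, where the derivative of [asin] blows
   up. Replacing cos d by r cos d with r = sin theta < 1 gives a smooth calibration that rises from
   -theta to theta. *)
assert (W : forall theta, 0 < theta < PI / 2 -> 2 * theta <= curve_length beta extremal_metric c).
{ intros theta Ht. set (r := sin theta).
  assert (Hr : 0 < r < 1).
  { split; [apply sin_gt_0; lra|]. rewrite <- sin_PI2. apply sin_increasing_1; lra. }
  assert (I := curve_length_ge beta extremal_metric c
    (fun u v => - asin (r * cos_dist b (u - x0) (v - m))) Hc).
  rewrite E0, E1 in I. simpl fst in I. simpl snd in I.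
  replace (x + PI + a - x0) with PI in I by (unfold x0; ring).
  replace (x + a - x0) with 0 in I by (unfold x0; ring).
  replace (e * y + m - m) with b in I by (unfold b; ring).
  replace (e * - y + m - m) with (- b) in I by (unfold b; ring).
  assert (F1 : cos_dist b 0 b = 1).
  { unfold cos_dist. rewrite cos_0. generalize (tanh_sq b). rewrite <- pow_inv. lra. }
  assert (F2 : cos_dist b PI (- b) = -1).
  { unfold cos_dist. rewrite cos_PI, cosh_opp, tanh_opp. generalize (tanh_sq b). rewrite <- pow_inv. lra. }
  rewrite F1, F2, Rmult_1_r in I. replace (r * -1) with (- r) in I by ring.
  assert (Er : asin r = theta) by (apply asin_sin; lra).
  rewrite asin_opp, Er in I.
  replace (2 * theta) with (- - theta - - theta) by ring. apply I.
  intros u v s du dv Hu Hv.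
  assert (Hu' : is_derive (fun r => u r - x0) s du).
  { auto_derive; [exact (ex_intro _ _ Hu)|]. rewrite (Derive_eta _ _ _ Hu). ring. }
  assert (Hv' : is_derive (fun r => v r - m) s dv).
  { auto_derive; [exact (ex_intro _ _ Hv)|]. rewrite (Derive_eta _ _ _ Hv). ring. }
  assert (D := is_derive_cos_dist b _ _ s du dv Hu' Hv'). cbv beta in D.
  set (w := cos_dist b (u s - x0) (v s - m)) in *.
  set (wx := cos_dist_x b (u s - x0) (v s - m)) in *.
  set (wy := cos_dist_y b (u s - x0) (v s - m)) in *.
  assert (Hw : w ^ 2 <= 1) by apply cos_dist_bound.
  assert (Hrw : (r * w) ^ 2 < 1) by (rewrite Rpow_mult_distr; nra).
  assert (Hrw' : -1 < r * w < 1) by (split; nra).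
  assert (Hsq : 0 < sqrt (1 - (r * w) ^ 2)) by (apply sqrt_lt_R0; lra).
  exists (- (r * (wx * du + wy * dv) * / sqrt (1 - (r * w) ^ 2))). split.
  - apply (is_derive_opp (V := R_NormedModule) (fun t => asin (r * cos_dist b (u t - x0) (v t - m)))).
    apply (is_derive_comp asin (fun t => r * cos_dist b (u t - x0) (v t - m))).
    + apply is_derive_asin, Hrw'.
    + apply is_derive_scal, D.
  - simpl phi. cbv beta. simpl snd.
    apply Rle_trans with (/ cosh (v s - m) * sqrt (du ^ 2 + dv ^ 2));
      [|apply Rmult_le_compat_r; [apply sqrt_pos|apply profile_ge]].
    assert (G := cos_dist_gradient b (u s - x0) (v s - m)). fold w wx wy in G.
    assert (HC : 0 < / cosh (v s - m)) by apply Rinv_0_lt_compat, cosh_pos.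
    rewrite <- pow_inv in G. set (C := / cosh (v s - m)) in *.
    assert (N := dot_product_le_norm (- (r * wx)) (- (r * wy)) du dv).
    (* The calibration is 1-Lipschitz for the sphere because r^2 (1 - w^2) <= 1 - (r w)^2. *)
    assert (M : sqrt ((- (r * wx)) ^ 2 + (- (r * wy)) ^ 2) <= sqrt (1 - (r * w) ^ 2) * C).
    { rewrite <- (sqrt_pow2 C) by lra. rewrite <- sqrt_mult_alt by lra. apply sqrt_le_1_alt.
      replace ((- (r * wx)) ^ 2 + (- (r * wy)) ^ 2) with (r ^ 2 * (wx ^ 2 + wy ^ 2)) by ring.
      rewrite G, <- Rmult_assoc. apply Rmult_le_compat_r; [apply pow2_ge_0|]. 
      assert (r ^ 2 <= 1) by nra. lra. }
    replace (- (r * (wx * du + wy * dv) * / sqrt (1 - (r * w) ^ 2)))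
      with ((- (r * wx) * du + - (r * wy) * dv) / sqrt (1 - (r * w) ^ 2)) by (field; lra).
    apply (Rle_div_l _ _ (sqrt (1 - (r * w) ^ 2))); [exact Hsq|].
    apply Rle_trans with (1 := N).
    replace (C * sqrt (du ^ 2 + dv ^ 2) * sqrt (1 - (r * w) ^ 2))
      with (sqrt (1 - (r * w) ^ 2) * C * sqrt (du ^ 2 + dv ^ 2)) by ring.
    apply Rmult_le_compat_r; [apply sqrt_pos|exact M]. }
assert (HPI := PI_RGT_0).
apply Rnot_lt_le. intros Hlt.
set (L := curve_length beta extremal_metric c) in *.
assert (HL : 0 <= L) by (apply curve_length_nonneg, Hc).
(* If L < PI, this theta is admissible and gives (L + PI) / 2 <= L, a contradiction. *)
specialize (W ((L + PI) / 4)). lra.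
Qed.

(** * Singular curves and local models of the extremal metric *)

Lemma off_curves_iff (z : C) :
  off_curves beta ((fun s => (2 * PI * s, Y)) :: (fun s => (2 * PI * s, - Y)) :: nil) z <->
  dist_lattice (snd z) <> Y.
Proof.
assert (HPI := PI_RGT_0). unfold off_curves. split; intros H.
- intros Hd. apply H. destruct z as [x y]. simpl in Hd.
  destruct (dist_lattice_attained y) as [k Hk]. rewrite Hd in Hk.
  (* Both circles y = Y and y = -Y are listed, so a translation alone carries one of them through
     the point. *)
  destruct (Gamma_translation beta (Int_part (x / (2 * PI))) k) as (h & Hh & E).
  destruct (base_Int_part (x / (2 * PI))) as [B1 B2].
  set (s := x / (2 * PI) - IZR (Int_part (x / (2 * PI)))).
  assert (Hs : 0 <= s <= 1) by (unfold s; lra).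
  assert (Hx : x = 2 * PI * s + IZR (Int_part (x / (2 * PI))) * (2 * PI)) by (unfold s; field; lra).
  unfold Rabs in Hk. destruct (Rcase_abs (y - IZR k * beta)).
  + exists (fun s => (2 * PI * s, - Y)), h, s. split; [right; left; reflexivity|].
    split; [exact Hh|split; [exact Hs|]]. rewrite E, <- Hx. f_equal. lra.
  + exists (fun s => (2 * PI * s, Y)), h, s. split; [left; reflexivity|].
    split; [exact Hh|split; [exact Hs|]]. rewrite E, <- Hx. f_equal. lra.
- intros (c & h & s & Hc & Hh & Hs & ->). apply H.
  assert (W : forall e, Rabs e = 1 -> dist_lattice (e * Y) = Y).
  { intros e He. rewrite dist_lattice_small; rewrite Rabs_mult, He, Rmult_1_l, Rabs_right; lra. }
  destruct (Gamma_form beta h Hh) as (e & a & k & He & E).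
  assert (Ha : Rabs e = 1 /\ Rabs (- e) = 1).
  { rewrite Rabs_Ropp. destruct He as [-> | ->]; [rewrite Rabs_R1|rewrite Rabs_m1]; auto. }
  destruct Hc as [<- | [<- | []]]; rewrite E; simpl; rewrite dist_lattice_translate.
  + apply W, Ha.
  + replace (e * - Y) with (- e * Y) by ring. apply W, Ha.
Qed.

Lemma piecewise_C1_horizontal (b : R) : piecewise_C1 (fun s => (2 * PI * s, b)).
Proof.
apply (piecewise_C1_smooth (fun s => 2 * PI * s) (fun _ => b) (fun _ => 2 * PI) (fun _ => 0)).
- intros s. auto_derive; [trivial|ring].
- intros s. apply (is_derive_const (V := R_NormedModule)).
- intros s. apply (continuous_const (V := R_UniformSpace)).
- intros s. apply (continuous_const (V := R_UniformSpace)).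
Qed.

Lemma locally_snd (P : R -> Prop) (z : C) : locally (snd z) P -> locally z (fun w : C => P (snd w)).
Proof. intros [d Hd]. exists d. intros w [_ Hw]. apply Hd, Hw. Qed.

(** The isometry is the inverse Mercator projection centred at the nearest lattice line. *)
Lemma round_near_extremal (z : C) :
  dist_lattice (snd z) < Y -> round_near beta 1 extremal_metric z.
Proof.
intros Hz. destruct (dist_lattice_attained (snd z)) as [k Hk]. rewrite Hk in Hz.
set (m := IZR k * beta) in *.
exists (fun w => eval m (Mul CosX SechY) (fst w) (snd w)),
  (fun w => eval m (Mul SinX SechY) (fst w) (snd w)), (fun w => eval m TanhY (fst w) (snd w)).
assert (L : locally (snd z) (fun y => Rabs (y - m) < Y)).
{ apply (continuous_Rabs_comp (fun y => y - m) (snd z)) with (P := fun r => r < Y).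
  - apply (ex_derive_continuous (fun y => y - m)). auto_derive. trivial.
  - apply (open_lt Y), Hz. }
apply locally_snd in L. revert L. apply filter_imp. intros w Hw.
assert (Hp : phi beta extremal_metric w = / cosh (snd w - m)) by (apply (profile_near (snd w) k); fold m; lra).
assert (Ty := tanh_sq (snd w - m)). rewrite <- pow_inv in Ty.
assert (Sx : sin (fst w) ^ 2 = 1 - cos (fst w) ^ 2) by (generalize (sin2_cos2 (fst w)); unfold Rsqr; lra).
split.
- unfold isometric_at. rewrite !dx_eval, !dy_eval, Hp. repeat split; try apply smooth_at_eval; simpl expr_dx; simpl expr_dy; simpl eval;
  set (S := / cosh (snd w - m)) in *; set (T := tanh (snd w - m)) in *;
  set (c := cos (fst w)) in *; set (s := sin (fst w)) in *.
  + transitivity (S ^ 2 * (s ^ 2 + c ^ 2)); [ring|]. rewrite Sx. ring.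
  + transitivity (S ^ 2 * (T ^ 2 * (s ^ 2 + c ^ 2) + S ^ 2)); [ring|]. rewrite Sx, Ty. ring.
  + ring.
- simpl eval. set (S := / cosh (snd w - m)) in *.
  transitivity (S ^ 2 * (cos (fst w) ^ 2 + sin (fst w) ^ 2) + tanh (snd w - m) ^ 2); [ring|].
  rewrite Sx, Ty. ring.
Qed.

Lemma flat_near_extremal (z : C) :
  Y < dist_lattice (snd z) -> flat_near beta 1 extremal_metric z.
Proof.
intros Hz. set (k := / cosh Y).
exists (fun w => eval 0 (Mul (Const k) VarX) (fst w) (snd w)),
  (fun w => eval 0 (Mul (Const k) VarY) (fst w) (snd w)).
assert (L : locally (snd z) (fun y => Y < dist_lattice y)).
{ apply (continuous_dist_lattice (snd z) (fun r => Y < r)). apply (open_gt Y), Hz. }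
apply locally_snd in L. revert L. apply filter_imp. intros w Hw.
assert (Hp : phi beta extremal_metric w = k) by (apply profile_far; lra).
change (fun _ : C => 0) with (fun w : C => eval 0 (Const 0) (fst w) (snd w)).
unfold isometric_at. rewrite !dx_eval, !dy_eval, Hp.
repeat split; try apply smooth_at_eval; simpl; ring.
Qed.

Lemma spherical_extremal_metric : Y = beta / 2 -> spherical beta extremal_metric.
Proof.
intros HY'. exists 1, ((fun s => (2 * PI * s, Y)) :: (fun s => (2 * PI * s, - Y)) :: nil).
split; [lra|split].
- repeat constructor; apply piecewise_C1_horizontal.
- intros z Hz. apply off_curves_iff in Hz. apply round_near_extremal.
  generalize (dist_lattice_max (snd z)). lra.
Qed.

Lemma flat_spherical_extremal_metric : Y < beta / 2 -> flat_spherical beta extremal_metric.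
Proof.
intros HY'. exists 1, ((fun s => (2 * PI * s, Y)) :: (fun s => (2 * PI * s, - Y)) :: nil).
assert (D0 : dist_lattice 0 = 0).
{ rewrite dist_lattice_small; rewrite Rabs_R0; lra. }
assert (D1 : dist_lattice (beta / 2) = beta / 2).
{ rewrite dist_lattice_small; rewrite Rabs_right; lra. }
split; [lra|split; [|split; [|split]]].
- repeat constructor; apply piecewise_C1_horizontal.
- intros z Hz. apply off_curves_iff in Hz. destruct (Rtotal_order (dist_lattice (snd z)) Y) as [H|[H|H]].
  + left. apply round_near_extremal, H.
  + contradiction.
  + right. apply flat_near_extremal, H.
- exists (0, 0). split.
  + apply off_curves_iff. simpl. lra.
  + apply round_near_extremal. simpl. lra.
- exists (0, beta / 2). split.
  + apply off_curves_iff. simpl. lra.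
  + apply flat_near_extremal. simpl. lra.
Qed.

(** Lower bounds for the two lengths suffice, the general inequality giving the other direction. *)
Lemma extremal_metric_equality (c : R) :
  0 < c -> c * cosh Y <= 1 -> (Y = beta / 2 \/ c * cosh Y = 1) ->
  tanh Y + (beta / 2 - Y) * / cosh Y ^ 2 = 2 * (tanh Y - c * atan (sinh Y)) ->
  2 * c * (l_v beta extremal_metric * l_sigma beta extremal_metric) = vol beta extremal_metric.
Proof.
intros Hc HcY Halt Hv. assert (HPI := PI_RGT_0).
apply Rle_antisym.
- apply (conformal_isosystolic_bound beta hbeta extremal_metric Y c hY Hc HcY Halt Hv).
- rewrite vol_extremal_metric.
  assert (Lv := l_v_extremal_metric). rewrite RInt_profile in Lv.
  assert (Ls := l_sigma_extremal_metric).
  set (a := 2 * (atan (sinh Y) + (beta / 2 - Y) * / cosh Y)) in *.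
  (* The balance once more: c a = v0, so the lower bounds a and PI for the lengths multiply to
     exactly vol / (2 c). *)
  assert (Ea : 2 * c * a = 2 * (tanh Y + (beta / 2 - Y) * / cosh Y ^ 2)).
  { unfold a. assert (HC := cosh_pos Y). destruct Halt as [E | E].
    - rewrite <- E in *. rewrite Rminus_diag in *. lra.
    - replace (/ cosh Y) with c by (apply Rmult_eq_reg_r with (cosh Y); [rewrite E; field; lra|lra]).
      replace (/ cosh Y ^ 2) with (c ^ 2) in *
        by (replace c with (/ cosh Y); [apply pow_inv|apply Rmult_eq_reg_r with (cosh Y); [rewrite E; field; lra|lra]]).
      lra. }
  assert (0 <= a).
  { unfold a. assert (0 <= (beta / 2 - Y) * / cosh Y).
    { apply Rmult_le_pos; [lra|]. left. apply Rinv_0_lt_compat, cosh_pos. }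
    assert (0 <= atan (sinh Y)); [|lra].
    rewrite <- atan_0. destruct (sinh_nonneg Y) as [H'|H']; [lra|left; apply atan_increasing, H'|rewrite <- H'; lra]. }
  replace (2 * PI * (tanh Y + (beta / 2 - Y) * / cosh Y ^ 2)) with (2 * c * (a * PI)) by (transitivity ((2 * c * a) * PI); [ring|rewrite Ea; ring]).
  apply Rmult_le_compat_l; [lra|]. apply Rmult_le_compat; lra.
Qed.

End ExtremalMetric.

(** * The parameter omega *)

Lemma cos_sq_sin (w : R) : cos w ^ 2 = 1 - sin w ^ 2.
Proof. generalize (sin2_cos2 w). unfold Rsqr. lra. Qed.

Lemma sin_bound_lt (w : R) : 0 < w < PI / 2 -> 0 < sin w < 1.
Proof.
intros Hw. split; [apply sin_gt_0; lra|]. rewrite <- sin_PI2. apply sin_increasing_1; lra.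
Qed.

(** Both sides are the Mercator ordinate of latitude [w], the inverse Gudermannian function. *)
Lemma ln_tan_artanh (w : R) : 0 < w < PI / 2 -> ln (tan (PI / 4 + w / 2)) = artanh (sin w).
Proof.
intros Hw. assert (Hs := sin_bound_lt w Hw). assert (Hc : 0 < cos w) by (apply cos_gt_0; lra).
assert (E : tan (PI / 4 + w / 2) = (1 + sin w) / cos w).
{ set (a := PI / 4 + w / 2).
  assert (Ha : 0 < sin a) by (apply sin_gt_0; unfold a; lra).
  assert (Hb : 0 < cos a) by (apply cos_gt_0; unfold a; lra).
  assert (H1 : cos w = 2 * sin a * cos a).
  { rewrite <- sin_2a. unfold a. rewrite <- sin_shift, <- sin_PI_x. f_equal. field. }
  assert (H2 : 1 + sin w = 2 * sin a * sin a).
  { assert (H := cos_2a_sin a). replace (2 * a) with (PI / 2 + w) in H by (unfold a; field).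
    assert (H' := sin_cos w). lra. }
  rewrite H1, H2. unfold tan. field. lra. }
rewrite E. unfold artanh.
replace ((1 + sin w) / (1 - sin w)) with ((1 + sin w) / cos w * ((1 + sin w) / cos w)).
- assert (0 < (1 + sin w) / cos w) by (apply Rdiv_lt_0_compat; lra).
  rewrite ln_mult by assumption. field.
- transitivity ((1 + sin w) ^ 2 / cos w ^ 2); [field; lra|]. rewrite cos_sq_sin. field. split; nra.
Qed.

Lemma cosh_artanh_sin (w : R) : 0 < w < PI / 2 -> cosh (artanh (sin w)) = / cos w.
Proof.
intros Hw. assert (Hs := sin_bound_lt w Hw). assert (Hc : 0 < cos w) by (apply cos_gt_0; lra).
rewrite <- (Rinv_inv (cosh _)), inv_cosh_artanh, <- cos_sq_sin, sqrt_pow2; lra.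
Qed.

Lemma atan_sinh_artanh_sin (w : R) : 0 < w < PI / 2 -> atan (sinh (artanh (sin w))) = w.
Proof.
intros Hw. assert (Hs := sin_bound_lt w Hw). assert (Hc : 0 < cos w) by (apply cos_gt_0; lra).
replace (sinh (artanh (sin w))) with (tan w); [apply atan_tan; lra|].
assert (T := tanh_artanh (sin w) ltac:(lra)). unfold tanh in T.
rewrite cosh_artanh_sin in T by exact Hw.
unfold tan. rewrite <- T at 1. field. lra.
Qed.

Lemma artanh_lt (a b : R) : -1 < a -> a < b -> b < 1 -> artanh a < artanh b.
Proof.
intros Ha Hab Hb. destruct (Rlt_or_le (artanh a) (artanh b)) as [H|H]; [exact H|].
apply tanh_le in H. rewrite !tanh_artanh in H by lra. lra.
Qed.

(** This is tan w / w, with derivative of the sign of w - sin w cos w. It makes b0 the only place in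
    ]0, PI / 2[ where tan w - 2 w changes sign. *)
Lemma tan_div_increasing (a b : R) : 0 < a -> a < b -> b < PI / 2 ->
  sin a / (a * cos a) < sin b / (b * cos b).
Proof.
intros Ha Hab Hb.
apply (incr_function (fun w => sin w / (w * cos w)) 0 (PI / 2)
  (fun w => (w - sin w * cos w) / (w * cos w) ^ 2)); simpl; try lra.
- intros w H1 H2. assert (Hc : 0 < cos w) by (apply cos_gt_0; lra).
  auto_derive; [repeat split; nra|].
  assert (E : w - sin w * cos w = w * (cos w ^ 2 + sin w ^ 2) - sin w * cos w) by (rewrite cos_sq_sin; ring).
  rewrite E. field. lra.
- intros w H1 H2. assert (Hc : 0 < cos w) by (apply cos_gt_0; lra).
  assert (Hs : 0 < sin w < 1) by (apply sin_bound_lt; lra).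
  assert (sin w < w) by (apply sin_lt_x; lra).
  assert (cos w <= 1) by apply COS_bound.
  assert (0 < w * cos w) by nra. apply Rdiv_lt_0_compat; nra.
Qed.

Lemma mul_cos_lt_sin (w : R) : 0 < w < PI / 2 -> w * cos w < sin w.
Proof.
intros Hw. set (f := fun w => sin w - w * cos w).
assert (Df : forall x, is_derive f x (x * sin x)).
{ intros x. unfold f. auto_derive; [trivial|ring]. }
(* The derivative w sin w vanishes at 0, so strictness is obtained only on the second half of the
   interval. *)
assert (H1 : f 0 <= f (w / 2)).
{ destruct (MVT_gen f 0 (w / 2) (fun w => w * sin w)) as [c [Hc E]].
  - intros x _. apply Df.
  - intros x _. apply continuity_pt_filterlim. exact (is_derive_continuous _ _ _ (Df x)).
  - rewrite Rmin_left, Rmax_right in Hc by lra.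
    assert (0 <= sin c) by (apply sin_ge_0; lra).
    assert (0 <= c * sin c * (w / 2 - 0)) by (repeat apply Rmult_le_pos; lra). lra. }
assert (H2 : f (w / 2) < f w).
{ apply (incr_function f 0 (PI / 2) (fun w => w * sin w)); simpl; try lra.
  - intros x _ _. apply Df.
  - intros x Hx1 Hx2. apply Rmult_lt_0_compat; [exact Hx1|apply sin_gt_0; lra]. }
unfold f in *. rewrite sin_0 in H1. lra.
Qed.

(* The equation of case (2), solved for beta. *)
Definition omega_period (w : R) : R :=
  2 * artanh (sin w) + (2 * sin w - 4 * w * cos w) / cos w ^ 2.

(** In the derivative the logarithmic and algebraic terms combine into a multiple of sin w - w cos
    w, positive because tan w > w. Uniqueness of omega rests on this. *)
Lemma omega_period_increasing (a b : R) : 0 < a -> a < b -> b < PI / 2 ->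
  omega_period a < omega_period b.
Proof.
intros Ha Hab Hb.
apply (incr_function omega_period 0 (PI / 2)
  (fun w => 4 * sin w * (sin w - w * cos w) / cos w ^ 3)); simpl; try lra.
- intros w H1 H2. assert (Hc : 0 < cos w) by (apply cos_gt_0; lra).
  assert (Hs : 0 < sin w < 1) by (apply sin_bound_lt; lra).
  assert (D := is_derive_artanh (sin w) ltac:(lra)).
  assert (D' : is_derive (fun w => artanh (sin w)) w (/ cos w)).
  { replace (/ cos w) with (cos w * / (1 - sin w ^ 2)) by (rewrite <- cos_sq_sin; field; lra).
    apply (is_derive_comp artanh sin); [exact D|apply is_derive_sin]. }
  unfold omega_period.
  replace (4 * sin w * (sin w - w * cos w) / (cos w * (cos w * (cos w * 1))))
    with (2 * / cos w + ((2 * cos w - 4 * cos w + 4 * w * sin w) * cos w ^ 2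
      - (2 * sin w - 4 * w * cos w) * (- 2 * sin w * cos w)) / (cos w ^ 2) ^ 2).
  + apply (is_derive_plus (V := R_NormedModule) (fun w => 2 * artanh (sin w))
      (fun w => (2 * sin w - 4 * w * cos w) / cos w ^ 2)).
    * apply is_derive_scal, D'.
    * auto_derive; [nra|]. field. lra.
  + assert (S : sin w ^ 2 = 1 - cos w ^ 2) by (rewrite cos_sq_sin; ring).
    field_simplify_eq; [|lra]. ring.
- intros w H1 H2. assert (Hc : 0 < cos w) by (apply cos_gt_0; lra).
  assert (Hs : 0 < sin w < 1) by (apply sin_bound_lt; lra).
  assert (H := mul_cos_lt_sin w ltac:(lra)).
  apply Rdiv_lt_0_compat; repeat first [lra | apply Rmult_lt_0_compat].
Qed.

Lemma omega_equation (beta w : R) : 0 < w < PI / 2 ->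
  2 * sin w = (beta - 2 * ln (tan (PI / 4 + w / 2))) * cos w ^ 2 + 4 * w * cos w <->
  omega_period w = beta.
Proof.
intros Hw. assert (Hc : 0 < cos w) by (apply cos_gt_0; lra).
rewrite ln_tan_artanh by exact Hw. unfold omega_period.
assert (Hc2 : 0 < cos w ^ 2) by (apply pow_lt, Hc). split; intros H.
- replace (2 * sin w - 4 * w * cos w) with ((beta - 2 * artanh (sin w)) * cos w ^ 2) by lra.
  field. lra.
- rewrite <- H. field. lra.
Qed.

Lemma omega_exists (b0 beta : R) :
  0 < b0 < PI / 2 -> sin b0 = 2 * b0 * cos b0 -> 0 < beta -> 2 * artanh (sin b0) < beta ->
  exists w, b0 < w < PI / 2 /\ omega_period w = beta.
Proof.
intros Hb Eb Hbeta Hlt. assert (HPI := PI_RGT_0).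
(* The latitude of height beta / 2. There the first term of [omega_period] already equals beta, and
   the second is positive since tan w1 > 2 w1; at b0 the second term vanishes and the first is below
   beta. *)
set (w1 := asin (tanh (beta / 2))).
assert (Ht : 0 < tanh (beta / 2) < 1) by (split; [apply tanh_pos; lra|apply tanh_bound]).
assert (S1 : sin w1 = tanh (beta / 2)) by (apply sin_asin; lra).
assert (Hw1 : - (PI / 2) < w1 < PI / 2) by (apply asin_bound_lt; lra).
assert (Hb1 : b0 < w1).
{ apply sin_increasing_0; try lra. rewrite S1.
  assert (Hs := sin_bound_lt b0 Hb). rewrite <- (tanh_artanh (sin b0)) by lra.
  destruct (Rlt_or_le (tanh (artanh (sin b0))) (tanh (beta / 2))) as [H|H]; [exact H|].
  destruct (Rle_lt_or_eq_dec _ _ H) as [H'|H'].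
  - exfalso. assert (artanh (sin b0) <= beta / 2) by lra. apply tanh_le in H0. lra.
  - apply tanh_inj in H'. lra. }
assert (Hc : forall w, b0 <= w <= w1 -> 0 < cos w) by (intros; apply cos_gt_0; lra).
destruct (Ranalysis5.IVT_interv (fun w => omega_period w - beta) b0 w1) as [w [Hw E]].
- intros w Hw. apply continuity_pt_filterlim.
  assert (Hs : 0 < sin w < 1) by (apply sin_bound_lt; lra).
  specialize (Hc w Hw). unfold omega_period.
  apply (continuous_minus (V := R_NormedModule)
    (fun w => 2 * artanh (sin w) + (2 * sin w - 4 * w * cos w) / cos w ^ 2) (fun _ => beta));
    [|apply (continuous_const (V := R_UniformSpace))].
  apply (continuous_plus (V := R_NormedModule) (fun w => 2 * artanh (sin w))
      (fun w => (2 * sin w - 4 * w * cos w) / cos w ^ 2)).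
  + apply (continuous_scal_r (V := R_NormedModule) 2 (fun w => artanh (sin w))).
    apply (continuous_comp sin artanh); [apply continuous_sin|].
    apply (is_derive_continuous _ _ _ (is_derive_artanh (sin w) ltac:(lra))).
  + apply (ex_derive_continuous (fun w => (2 * sin w - 4 * w * cos w) / cos w ^ 2)).
    auto_derive. nra.
- exact Hb1.
- unfold omega_period. rewrite Eb at 2. replace (2 * (2 * b0 * cos b0) - 4 * b0 * cos b0) with 0 by ring.
  rewrite Rdiv_0_l. lra.
- unfold omega_period. rewrite S1, artanh_tanh.
  assert (T := tan_div_increasing b0 w1 ltac:(lra) Hb1 ltac:(lra)).
  assert (C0 := Hc b0 ltac:(lra)). assert (C1 := Hc w1 ltac:(lra)).
  replace (sin b0 / (b0 * cos b0)) with 2 in T by (rewrite Eb; field; lra).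
  apply (Rlt_div_r 2 (sin w1) (w1 * cos w1)) in T; [|nra]. rewrite <- S1.
  assert (0 < (2 * sin w1 - 4 * w1 * cos w1) / cos w1 ^ 2); [|lra].
  apply Rdiv_lt_0_compat; [lra|apply pow_lt, C1].
- exists w. assert (Ew : omega_period w = beta) by lra. split; [|exact Ew].
  split; [|lra]. destruct (proj1 Hw) as [H|<-]; [exact H|]. exfalso.
  unfold omega_period in Ew. rewrite Eb in Ew at 2.
  replace (2 * (2 * b0 * cos b0) - 4 * b0 * cos b0) with 0 in Ew by ring. rewrite Rdiv_0_l in Ew. lra.
Qed.

(** * From the height [Y] and the weight c to the two cases *)

Lemma tanh_half (beta : R) : (exp beta - 1) / (exp beta + 1) = tanh (beta / 2).
Proof.
assert (E : exp beta = exp (beta / 2) * exp (beta / 2)) by (rewrite <- exp_plus; f_equal; field).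
unfold tanh, sinh, cosh. rewrite exp_Ropp, E. assert (P := exp_pos (beta / 2)).
field. split; nra.
Qed.

(** The conditions on [Y] and [c] are those of an admissible splitting: nonnegative weights, a
    density beyond [Y] that vertical curves alone account for, and equal contributions. The type of
    the metric depends only on whether a flat band is left. *)
Lemma isosystolic_sharp (beta Y c : R) :
  0 < beta -> 0 < Y <= beta / 2 -> 0 < c -> c * cosh Y <= 1 -> (Y = beta / 2 \/ c * cosh Y = 1) ->
  tanh Y + (beta / 2 - Y) * / cosh Y ^ 2 = 2 * (tanh Y - c * atan (sinh Y)) ->
  (forall g : conformal_metric beta, l_v beta g * l_sigma beta g <= 1 / (2 * c) * vol beta g) /\
  exists g : conformal_metric beta,
    (Y = beta / 2 -> spherical beta g) /\ (Y < beta / 2 -> flat_spherical beta g) /\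
    l_v beta g * l_sigma beta g = 1 / (2 * c) * vol beta g.
Proof.
intros Hbeta HY Hc HcY Halt Hv. split.
- intros g. assert (I := conformal_isosystolic_bound beta Hbeta g Y c HY Hc HcY Halt Hv).
  apply Rmult_le_reg_l with (2 * c); [lra|]. apply Rle_trans with (1 := I). right. field. lra.
- exists (extremal_metric beta Hbeta Y).
  assert (I := extremal_metric_equality beta Hbeta Y HY c Hc HcY Halt Hv).
  split; [|split].
  + apply (spherical_extremal_metric beta Hbeta Y HY).
  + apply (flat_spherical_extremal_metric beta Hbeta Y HY).
  + rewrite <- I. field. lra.
Qed.

Theorem theorem1p1 (b0 : R) (hb0 : 0 < b0 < PI / 2) (hb0tan : tan b0 = 2 * b0)
    (beta : R) (hbeta : 0 < beta) :
  (beta <= 2 * ln (tan (PI / 4 + b0 / 2)) ->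
     (forall g : conformal_metric beta,
        l_v beta g * l_sigma beta g <=
        asin ((exp beta - 1) / (exp beta + 1)) / ((exp beta - 1) / (exp beta + 1))
          * vol beta g) /\
     (exists g : conformal_metric beta,
        spherical beta g /\
        l_v beta g * l_sigma beta g =
        asin ((exp beta - 1) / (exp beta + 1)) / ((exp beta - 1) / (exp beta + 1))
          * vol beta g)) /\
  (2 * ln (tan (PI / 4 + b0 / 2)) < beta ->
     exists omega : R,
       unique (fun w : R =>
         b0 <= w < PI / 2 /\
         2 * sin w =
           (beta - 2 * ln (tan (PI / 4 + w / 2))) * cos w ^ 2 + 4 * w * cos w) omega /\
       (forall g : conformal_metric beta,
          l_v beta g * l_sigma beta g <= 1 / (2 * cos omega) * vol beta g) /\
       (exists g : conformal_metric beta,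
          flat_spherical beta g /\
          l_v beta g * l_sigma beta g = 1 / (2 * cos omega) * vol beta g)).
Proof.
assert (HPI := PI_RGT_0).
assert (Hcb : 0 < cos b0) by (apply cos_gt_0; lra).
assert (Eb : sin b0 = 2 * b0 * cos b0) by (rewrite <- hb0tan; unfold tan; field; lra).
rewrite (ln_tan_artanh b0 hb0), tanh_half. split; intros Hbeta.
(* Here [Y] = beta / 2, and [b] is the latitude of that height. *)
- set (u := tanh (beta / 2)). set (b := asin u).
  assert (Hu : 0 < u < 1) by (split; [apply tanh_pos; lra|apply tanh_bound]).
  assert (Sb : sin b = u) by (apply sin_asin; lra).
  assert (Hb : 0 < b < PI / 2).
  { split; [|apply asin_bound_lt; lra]. rewrite <- asin_0. unfold b.
    destruct (Rlt_or_le (asin 0) (asin u)) as [H|H]; [exact H|].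
    assert (B := asin_bound u). rewrite asin_0 in H. fold b in H, B.
    assert (sin b <= sin 0) by (apply sin_incr_1; lra). rewrite sin_0 in *. lra. }
  assert (EY : artanh (sin b) = beta / 2) by (rewrite Sb; apply artanh_tanh).
  assert (Hc : 0 < cos b) by (apply cos_gt_0; lra).
  (* This is tan b <= 2 b, the constraint c cosh Y <= 1 in disguise, and it holds because the
     hypothesis on beta says b <= b0. *)
  assert (Hbb : sin b <= 2 * b * cos b).
  { destruct (Rtotal_order b b0) as [H|[->|H]].
    - assert (T := tan_div_increasing b b0 ltac:(lra) H ltac:(lra)).
      replace (sin b0 / (b0 * cos b0)) with 2 in T by (rewrite Eb; field; lra).
      apply (Rlt_div_l (sin b) 2 (b * cos b)) in T; [lra|nra].
    - lra.
    - exfalso. assert (Hs := sin_bound_lt b0 hb0).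
      assert (sin b0 < sin b) by (apply sin_increasing_1; lra).
      assert (A := artanh_lt (sin b0) (sin b) ltac:(lra) ltac:(lra) ltac:(lra)). lra. }
  assert (C := cosh_artanh_sin b Hb). assert (A := atan_sinh_artanh_sin b Hb). rewrite EY in C, A.
  (* The balance reduces to u = 2 (u - c b), whence this value of c. *)
  destruct (isosystolic_sharp beta (beta / 2) (u / (2 * b))) as [H1 (g & H2 & _ & H3)].
  + exact hbeta.
  + lra.
  + apply Rdiv_lt_0_compat; lra.
  + rewrite C, <- Sb. replace (sin b / (2 * b) * / cos b) with (sin b / (2 * b * cos b)) by (field; lra).
    apply (Rle_div_l (sin b) 1 (2 * b * cos b)); [nra|lra].
  + left. reflexivity.
  + rewrite A, Rminus_diag, Rmult_0_l. fold u. field. lra.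
  + replace (1 / (2 * (u / (2 * b)))) with (b / u) in H1, H3 by (field; lra).
    split; [exact H1|]. exists g. split; [apply H2; reflexivity|exact H3].
- destruct (omega_exists b0 beta hb0 Eb hbeta Hbeta) as (w & Hw & Ew).
  exists w. assert (Hw' : 0 < w < PI / 2) by lra.
  assert (Hc : 0 < cos w) by (apply cos_gt_0; lra).
  assert (Hs := sin_bound_lt w Hw').
  split; [split|].
  + split; [lra|]. apply omega_equation; [exact Hw'|exact Ew].
  + intros w' [Hw1 Hw2]. apply omega_equation in Hw2; [|lra].
    destruct (Rtotal_order w w') as [H|[H|H]]; [|exact H|].
    * assert (M := omega_period_increasing w w' ltac:(lra) H ltac:(lra)). lra.
    * assert (M := omega_period_increasing w' w ltac:(lra) H ltac:(lra)). lra.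
  + set (Y := artanh (sin w)).
    assert (TY : tanh Y = sin w) by (apply tanh_artanh; lra).
    assert (HY0 : 0 < Y).
    { destruct (Rlt_or_le 0 Y) as [H|H]; [exact H|]. apply tanh_le in H. rewrite tanh_0, TY in H. lra. }
    assert (T := tan_div_increasing b0 w ltac:(lra) ltac:(lra) ltac:(lra)).
    replace (sin b0 / (b0 * cos b0)) with 2 in T by (rewrite Eb; field; lra).
    apply (Rlt_div_r 2 (sin w) (w * cos w)) in T; [|nra].
    assert (Hc2 : 0 < cos w ^ 2) by (apply pow_lt, Hc).
    assert (EQ : (beta - 2 * Y) * cos w ^ 2 = 2 * sin w - 4 * w * cos w).
    { rewrite <- Ew. unfold omega_period. fold Y. field. lra. }
    (* A flat band remains: the right side of [EQ] is positive, as tan w > 2 w beyond b0. *)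
    assert (HYb : Y < beta / 2) by nra.
    assert (C := cosh_artanh_sin w Hw'). assert (A := atan_sinh_artanh_sin w Hw'). fold Y in C, A.
    (* With c = cos w = 1 / cosh Y, the balance is [EQ] divided by 2. *)
    destruct (isosystolic_sharp beta Y (cos w)) as [H1 (g & _ & H2 & H3)].
    * exact hbeta.
    * lra.
    * exact Hc.
    * rewrite C. right. field. lra.
    * right. rewrite C. field. lra.
    * rewrite TY, A, C, pow_inv, Rinv_inv. lra.
    * split; [exact H1|]. exists g. split; [apply H2, HYb|exact H3].
Qed.
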